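(* Let $n\ge 2$ and $d\in\{1,\ldots,n-1\}$. There exists an explicit constant $C_d>0$ such that for any $(\gamma_1,\ldots,\gamma_{n-d})\in[C_d,+\infty[^{\,n-d}$ there exists $A\in\mathcal{I}_n(d,n-d)_1$ satisfying $$\forall e\in\{1,\ldots,n-d\},\qquad \mu_n(A|e)_1=\max_{0\le i\le n-d-e}\gamma_{i+1}\gamma_{i+2}\cdots\gamma_{i+e}.$$
   Context: Norms on $\mathbb{R}^n$ and its exterior powers are Euclidean (the standard basis of each exterior power being orthonormal). A subspace of $\mathbb{R}^n$ is rational if it has a basis of vectors with rational coordinates; $\mathcal{R}_n(e)$ is the set of rational subspaces of dimension $e$ of $\mathbb{R}^n$. The height of $B\in\mathcal{R}_n(e)$ is $H(B)=\|X_1\wedge\cdots\wedge X_e\|$ for any $\mathbb{Z}$-basis $X_1,\ldots,X_e$ of $B\cap\mathbb{Z}^n$ (equivalently, the Euclidean norm of a vector of Plücker coordinates of $B$ with coprime integer entries). Put $g(d,e,n)=\max(0,d+e-n)$. For $1\le j\le \min(d,e)-g(d,e,n)$, a subspace $A$ of dimension $d$ of $\mathbb{R}^n$ is $(e,j)$-irrational if $\dim(A\cap B)<j+g(d,e,n)$ for all $B\in\mathcal{R}_n(e)$; $\mathcal{I}_n(d,e)_j$ is the set of all $(e,j)$-irrational subspaces of dimension $d$ of $\mathbb{R}^n$. For nonzero $X,Y\in\mathbb{R}^n$, $\omega(X,Y)=\|X\wedge Y\|/(\|X\|\,\|Y\|)$. For subspaces $A,B$ of dimensions $d,e$, define inductively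 $\omega_1(A,B)=\min\{\omega(X,Y): X\in A\setminus\{0\},Y\in B\setminus\{0\}\}$, attained at $(X_1,Y_1)$, and, for $j<\min(d,e)$, $\omega_{j+1}(A,B)=\min\{\omega(X,Y): X\in A_j\setminus\{0\},Y\in B_j\setminus\{0\}\}$, attained at $(X_{j+1},Y_{j+1})$, where $A_j$ (resp. $B_j$) is the orthogonal complement of $\mathrm{Span}(X_1,\ldots,X_j)$ in $A$ (resp. of $\mathrm{Span}(Y_1,\ldots,Y_j)$ in $B$). Set $\psi_j(A,B)=\omega_{j+g(d,e,n)}(A,B)$. For $d,e\in\{1,\ldots,n-1\}$, $1\le j\le\min(d,e)-g(d,e,n)$ and $A\in\mathcal{I}_n(d,e)_j$, the exponent $\mu_n(A|e)_j\in[0,+\infty]$ is the supremum of the set of $\mu>0$ such that there are infinitely many $B\in\mathcal{R}_n(e)$ with $\psi_j(A,B)\le H(B)^{-\mu}$. The constant $C_d$ depends only on $d$ and the fixed integer $n$; the explicit value taken in the paper is $C_1=2+\frac{\sqrt5-1}{2}$ and $C_d=5n^2(C_{d-1})^{2n}$ for $2\le d\le n-1$. *)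

(* Defs.v *)
From HB Require Import structures.
From mathcomp Require Import all_boot all_order all_algebra.
From mathcomp Require Import all_classical all_reals all_analysis.
Set Implicit Arguments.
Unset Strict Implicit.
Unset Printing Implicit Defensive.
Import Order.TTheory GRing.Theory Num.Theory.
Local Open Scope classical_set_scope.
Local Open Scope ring_scope.

(* max (0, d + e - n), the subtraction being truncated. *)
Definition gdim (d e n : nat) : nat := (d + e - n)%N.

Section Euclidean.
Context {R : realType} {n : nat}.

Definition dot (x y : 'rV[R]_n) : R := \sum_i x ord0 i * y ord0 i.

(* Not the norm `|x| of 'rV[R]_n, which is the sup norm. *)
Definition enorm (x : 'rV[R]_n) : R := Num.sqrt (dot x x).

(* Norm of the wedge product of the rows of X. Its coordinates on the
   orthonormal basis of the vectors e_(t 0) /\ ... /\ e_(t (k - 1)), for t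
   strictly increasing, are the k x k minors of X. *)
Definition wedge_norm (k : nat) (X : 'M[R]_(k, n)) : R :=
  Num.sqrt (\sum_(t : k.-tuple 'I_n | sorted ltn [seq val i | i <- t])
    (\det (colsub (tnth t) X)) ^+ 2).

Definition omega (x y : 'rV[R]_n) : R :=
  wedge_norm (col_mx x y) / (enorm x * enorm y).

End Euclidean.

Section Rational.
Context {R : realType} {n : nat}.
Implicit Types (A B : {vspace 'rV[R]_n}) (d e j : nat).

Definition is_rational B : Prop :=
  exists2 X : seq 'rV[R]_n, basis_of B X &
    forall x, x \in X -> forall i, exists q : rat, x ord0 i = ratr q.

Definition rational_subspaces e : set {vspace 'rV[R]_n} :=
  [set B | \dim B = e /\ is_rational B].

Definition integer_points B : set 'rV[R]_n :=
  [set x | x \in B /\ forall i, x ord0 i \is a Num.int].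

Definition is_Zbasis (k : nat) (L : set 'rV[R]_n) (X : 'M[R]_(k, n)) : Prop :=
  (forall i, L (row i X)) /\
  (forall x, L x -> exists! c : 'rV[int]_k, x = map_mx intr c *m X).

(* The Z-basis is arbitrary, see [height_Zbasis]; one exists as soon as B is
   rational. *)
Definition height B : R :=
  wedge_norm (xget 0 [set X : 'M[R]_(\dim B, n)
                      | is_Zbasis (integer_points B) X]).

Lemma Zbasis_unimodular (k : nat) (L : set 'rV[R]_n) (X Y : 'M[R]_(k, n)) :
  is_Zbasis L X -> is_Zbasis L Y ->
  exists2 U : 'M[int]_k, X = map_mx intr U *m Y & U \in unitmx.
Proof.
move=> [LX bX] [LY bY].
have ex (Z W : 'M[R]_(k, n)) : (forall i, L (row i Z)) ->
    (forall x, L x -> exists! c : 'rV[int]_k, x = map_mx intr c *m W) ->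
    exists U : 'M[int]_k, Z = map_mx intr U *m W.
  move=> LZ bW.
  have /choice[f fP] : forall i, exists c : 'rV[int]_k,
      row i Z = map_mx intr c *m W.
    by move=> i; have [c [cP _]] := bW _ (LZ i); exists c.
  exists (\matrix_i f i); apply/row_matrixP => i.
  by rewrite fP row_mul -map_row rowK.
have [U XU] := ex X Y LX bY; have [V YV] := ex Y X LY bX.
exists U => //.
suff /mulmx1_unit[] : U *m V = 1%:M by [].
apply/row_matrixP => i; have [c [_ uc]] := bX _ (LX i).
rewrite -(uc (row i (U *m V))) ?(uc (row i 1%:M)) //.
  by rewrite map_row map_mx1 -row_mul mul1mx.
by rewrite map_row -row_mul map_mxM -mulmxA -YV -XU.
Qed.

Lemma height_Zbasis B (X : 'M[R]_(\dim B, n)) :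
  is_Zbasis (integer_points B) X -> height B = wedge_norm X.
Proof.
move=> bX; rewrite /height.
case: xgetP => [Y _ bY|/(_ X)//].
have [U -> Uu] := Zbasis_unimodular bY bX.
rewrite /wedge_norm; congr Num.sqrt; apply: eq_bigr => t _.
have -> : colsub (tnth t) (map_mx intr U *m X) =
    map_mx intr U *m colsub (tnth t) X.
  by apply/matrixP => i j; rewrite !mxE; apply: eq_bigr => l _; rewrite !mxE.
rewrite det_mulmx det_map_mx exprMn -rmorphXn /=.
suff -> : (\det U) ^+ 2 = 1 by rewrite mul1r.
by move: Uu; rewrite unitmxE => /orP[/eqP ->|/eqP ->].
Qed.

End Rational.

Section Angles.
Context {R : realType} {n : nat}.
Implicit Types (A B : {vspace 'rV[R]_n}) (S T : set 'rV[R]_n) (d e j : nat).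

Definition omega_argmin S T : 'rV[R]_n * 'rV[R]_n :=
  xget (0, 0) [set p | [/\ S p.1, p.1 != 0, T p.2, p.2 != 0 &
    forall x y, S x -> x != 0 -> T y -> y != 0 ->
      omega p.1 p.2 <= omega x y]].

Definition orth_in A (s : seq 'rV[R]_n) : set 'rV[R]_n :=
  [set x | x \in A /\ forall y, y \in s -> dot x y = 0].

(* [:: (X_1, Y_1); ...; (X_j, Y_j)] *)
Fixpoint argmins A B j : seq ('rV[R]_n * 'rV[R]_n) :=
  if j is j'.+1 then
    let s := argmins A B j' in
    rcons s (omega_argmin (orth_in A (unzip1 s)) (orth_in B (unzip2 s)))
  else [::].

(* omega_j for 1 <= j <= min (dim A) (dim B). *)
Definition omega_ j A B : R :=
  let p := last (0, 0) (argmins A B j) in omega p.1 p.2.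

Definition psi j A B : R := omega_ (j + gdim (\dim A) (\dim B) n) A B.

Definition irrational_subspaces d e j : set {vspace 'rV[R]_n} :=
  [set A | \dim A = d /\ forall B, rational_subspaces e B ->
    (\dim (A :&: B) < j + gdim d e n)%N].

(* The supremum is taken in [0, +oo], hence the added 0. *)
Definition exponent A e j : \bar R :=
  ereal_sup (0%E |` [set mu%:E | mu in [set mu : R | 0 < mu /\
    infinite_set [set B | rational_subspaces e B /\
      psi j A B <= height B `^ (- mu)]]]).

End Angles.

(* C_1 = 2 + (sqrt 5 - 1) / 2 and C_d = 5 n^2 C_(d-1)^(2n). *)
Definition Cst (R : realType) (n d : nat) : R :=
  iter d.-1 (fun c => 5 * n%:R ^+ 2 * c ^+ (2 * n)) (2 + (Num.sqrt 5 - 1) / 2).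

(* Main.v *)
Require Import Defs.
From HB Require Import structures.
From mathcomp Require Import all_boot all_order all_fingroup all_algebra.
From mathcomp Require Import all_classical all_reals all_analysis.
From mathcomp Require Import ring lra zify.

(** Write [m = n - d] and [r = d - 1], so that [R^n] is the product of a first
    factor [R^(m+1)] and of [R^r]. The subspace [A] is spanned by one vector [Y]
    of the first factor ([target]), which carries all the prescribed exponents,
    and by the graph of a generic linear map [eta] from [R^r] to the first factor,
    whose only role is to raise the dimension without creating new approximations.

    The vector [Y] is the limit of the directions of integer vectors ([approx])
    obtained from each other by [X_(k+1) = a_k X_k + E_k], where the [E_k] run
    cyclically through [m] basis vectors and the first coordinate [q_k], a power
    of 2, satisfies [q_(k+1) ~ q_k ^ g_k]. Modulo [X_k] the next vectors are unit
    vectors, so the span of [X_k, ..., X_(k+e-1)] has height about [q_k] only,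
    while its angle with [Y] is about [1 / q_(k+e)]: it approximates [A] with the
    exponent [g_k ... g_(k+e-1)]. The sequence [g] ([ratios]) repeats the given
    ratios separated by long blocks of the constant [C_d], so that the largest
    product of [e] consecutive terms is the maximum of the statement and is
    attained infinitely often; this gives the lower bound [exponent_ge].

    For the upper bound [exponent_le] it suffices, by finiteness of the set of
    rational subspaces of bounded height, to bound below by [c h ^ - mu] the angle
    of [A] with every rational [B] of dimension [e] and height [h] ([core_bound]).
    This bound also shows that [A] is irrational.

    If [B] lies in the first factor ([sharp_bound]), let [k] be the scale past
    which consecutive [q_l] are further apart than [h]. Either
    [X_k, ..., X_(k+e-1)] all lie in [B], which is then one of the subspaces above,
    of height at least [q_k] because their lattice is primitive; or [B] misses some
    [X_l] among them, so that the wedge product of [X_l] with [B] has a nonzero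
    integral coordinate and that of [Y] is at least [1 / (2 q_l)]. In the second
    case the bound obtained is good enough because every [g_k] is at least the
    root [C_1 = 1 + golden ratio] of [x ^ 2 - 3 x + 1] ([window_gap_sharp]).

    If [B] is not contained in the first factor ([skew_bound]), then [d >= 2], the
    ratios are huge, and one may lose any fixed power of [h]. The wedge product of
    [Y] with the projection of [B] along the graph of [eta] is affine in each
    entry of [eta]. It is large at some point [p] depending on [B]: the projection
    can be made integral, keeping the vectors of [B] which are in the first factor
    and replacing the others by unit vectors, so that it misses some [X_l]
    ([skew_witness]). Since an affine function which is large at one point is
    small only on a short interval, a measure argument, applied to one entry of
    [eta] after the other, gives an [eta] at which all these countably many
    products are large at once ([generic_point], [generic_graph]).

    In the lemmas, subspaces of dimension [e + 1] are indexed by [e]. *)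

Set Implicit Arguments.
Unset Strict Implicit.
Unset Printing Implicit Defensive.
Import Order.TTheory GRing.Theory Num.Theory numFieldNormedType.Exports.
Local Open Scope classical_set_scope.
Local Open Scope ring_scope.

(** * Minors of a matrix *)

Section Minors.
Context {R : realType}.

(** The sum runs over all choices of columns, with repetitions and in any order:
    up to constants this is [wedge_norm], without the sorted tuples. *)
Definition minors (k n : nat) (X : 'M[R]_(k, n)) : R :=
  \sum_(f : {ffun 'I_k -> 'I_n}) `|\det (colsub f X)|.

Lemma minors_ge0 k n (X : 'M[R]_(k, n)) : 0 <= minors X.
Proof. by apply: sumr_ge0. Qed.

Lemma det_le (k : nat) (M : 'M[R]_k) (rho : 'I_k -> R) :
  (forall i j, `|M i j| <= rho i) -> `|\det M| <= k`!%:R * \prod_i rho i.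
Proof.
move=> Mrho; rewrite /determinant; apply: le_trans (ler_norm_sum _ _ _) _.
apply: (@le_trans _ _ (\sum_(s : 'S_k) \prod_i rho i)).
  apply: ler_sum => s _; rewrite normrM normrX normrN1 expr1n mul1r normr_prod.
  by apply: ler_prod => i _; rewrite normr_ge0 Mrho.
by rewrite sumr_const card_Sn mulr_natl.
Qed.

Lemma minor_le_minors k n (X : 'M[R]_(k, n)) (f : 'I_k -> 'I_n) :
  `|\det (colsub f X)| <= minors X.
Proof.
rewrite /minors (bigD1 (finfun f)) //=.
have -> : colsub (finfun f) X = colsub f X.
  by apply/matrixP => i j; rewrite !mxE ffunE.
by rewrite lerDl; apply: sumr_ge0.
Qed.

Lemma minors_le_const k n (X : 'M[R]_(k, n)) (h : R) :
  (forall f : {ffun 'I_k -> 'I_n}, `|\det (colsub f X)| <= h) ->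
  minors X <= (n ^ k)%:R * h.
Proof.
move=> Xh; apply: (le_trans (ler_sum _ (fun f _ => Xh f))).
by rewrite sumr_const card_ffun !card_ord mulr_natl.
Qed.

Lemma wedge_norm_ge0 k n (X : 'M[R]_(k, n)) : 0 <= wedge_norm X.
Proof. exact: sqrtr_ge0. Qed.

Lemma wedge_le_minors k n (X : 'M[R]_(k, n)) : wedge_norm X <= minors X.
Proof.
rewrite -[leRHS](ger0_norm (minors_ge0 X)) -sqrtr_sqr; apply: ler_wsqrtr.
set S := \sum_(t | _) _.
pose g (t : k.-tuple 'I_n) : {ffun 'I_k -> 'I_n} := [ffun i => tnth t i].
have injg : injective g.
  move=> s t /ffunP st; apply: eq_from_tnth => i.
  by have := st i; rewrite !ffunE.
have -> : S = \sum_(t : k.-tuple 'I_n | sorted ltn [seq val i | i <- t])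
    `|\det (colsub (g t) X)| ^+ 2.
  apply: eq_bigr => t _; rewrite real_normK ?num_real //; congr ((\det _) ^+ 2).
  by apply/matrixP => i j; rewrite !mxE ffunE.
apply: (@le_trans _ _ (\sum_(t : k.-tuple 'I_n) `|\det (colsub (g t) X)| ^+ 2)).
  by rewrite big_mkcond; apply: ler_sum => t _; case: ifP => // _; apply: sqr_ge0.
apply: (@le_trans _ _ (\sum_(f : {ffun 'I_k -> 'I_n}) `|\det (colsub f X)| ^+ 2)).
  rewrite -(big_imset (fun f : {ffun 'I_k -> 'I_n} => `|\det (colsub f X)| ^+ 2)
    (in2W injg)) /= big_mkcond /=.
  by apply: ler_sum => t _; case: ifP => // _; apply: sqr_ge0.
rewrite expr2 {2}/minors mulr_sumr; apply: ler_sum => f _; rewrite expr2.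
by apply: ler_wpM2r => //; apply: minor_le_minors.
Qed.

(** Reordering the columns of a minor with distinct columns only changes its
    sign, so the sorted minors control all of them. *)
Lemma minor_le_wedge k n (X : 'M[R]_(k, n)) (f : 'I_k -> 'I_n) :
  `|\det (colsub f X)| <= wedge_norm X.
Proof.
have [injf|/injectivePn[i [j ij fij]]] := boolP (injectiveb f); last first.
  suff -> : \det (colsub f X) = 0 by rewrite normr0 wedge_norm_ge0.
  rewrite -det_tr; apply: (determinant_alternate ij) => l.
  by rewrite !mxE fij.
move/injectiveP in injf.
pose s := [seq f i | i <- enum 'I_k].
have us : uniq s by rewrite map_inj_uniq ?enum_uniq.
pose t0 := sort (fun a b : 'I_n => (a <= b)%N) s.
have st0 : size t0 == k by rewrite size_sort size_map size_enum_ord.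
pose t := Tuple st0.
have sort_t : sorted ltn [seq val i | i <- t].
  rewrite ltn_sorted_uniq_leq map_inj_uniq ?sort_uniq ?us //=; last exact: val_inj.
  by rewrite sorted_map; apply: sort_sorted => a b; apply: leq_total.
have ut : uniq t by rewrite sort_uniq.
have ft i : f i \in t by rewrite mem_sort map_f ?mem_enum.
have idx i : (index (f i) t < k)%N by rewrite -[X in (_ < X)%N](size_tuple t) index_mem.
pose p i := Ordinal (idx i).
have tp i : tnth t (p i) = f i by rewrite (tnth_nth (f i)) nth_index.
have injp : injective p by move=> i j pij; apply: injf; rewrite -!tp pij.
have -> : colsub f X = col_perm (perm injp) (colsub (tnth t) X).
  by apply/matrixP => i j; rewrite !mxE permE tp.
rewrite col_permE det_mulmx det_perm normrM normrX normrN1 expr1n mulr1.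
rewrite -sqrtr_sqr; apply: ler_wsqrtr.
rewrite (bigD1 t) //= lerDl; apply: sumr_ge0 => u _; exact: sqr_ge0.
Qed.

Lemma colsub_mul (K : nzRingType) k l n p (U : 'M[K]_(k, l)) (X : 'M[K]_(l, n))
    (f : 'I_p -> 'I_n) :
  colsub f (U *m X) = U *m colsub f X.
Proof.
by apply/matrixP => i j; rewrite !mxE; apply: eq_bigr => a _; rewrite !mxE.
Qed.

Lemma wedge_norm_mul k n (U : 'M[R]_k) (X : 'M[R]_(k, n)) :
  wedge_norm (U *m X) = `|\det U| * wedge_norm X.
Proof.
rewrite /wedge_norm -sqrtr_sqr -sqrtrM ?sqr_ge0 // mulr_sumr.
by congr Num.sqrt; apply: eq_bigr => t _; rewrite colsub_mul det_mulmx exprMn.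
Qed.

(** Laplace expansion along the first row, the cofactors being minors of the
    other rows. *)
Lemma minor_col_mx k n (y : 'rV[R]_n) (X : 'M[R]_(k, n)) (f : 'I_(1 + k) -> 'I_n) :
  \det (colsub f (col_mx y X)) =
  \sum_(j < 1 + k) y 0 (f j) * ((-1) ^+ j * \det (colsub (fun i => f (lift j i)) X)).
Proof.
rewrite (expand_det_row _ (lshift k 0)); apply: eq_bigr => j _.
rewrite mxE col_mxEu /cofactor /= add0n; congr (_ * (_ * \det _)).
apply/matrixP => a c; rewrite !mxE.
case: splitP => [d /=|d /=]; first by rewrite ord1 /bump /= => /eqP.
by rewrite /bump /= => /eqP; rewrite !add1n eqSS => /eqP /ord_inj ->.
Qed.

Lemma minor_col_mx_lin k n (a : R) (y z : 'rV[R]_n) (X : 'M[R]_(k, n)) f :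
  \det (colsub f (col_mx (a *: y + z) X)) =
  a * \det (colsub f (col_mx y X)) + \det (colsub f (col_mx z X)).
Proof.
rewrite !minor_col_mx mulr_sumr -big_split /=; apply: eq_bigr => j _.
by rewrite !mxE mulrDl mulrA.
Qed.

Lemma minor_col_mx_le k n (y : 'rV[R]_n) (X : 'M[R]_(k, n)) (t : R)
    (f : 'I_(1 + k) -> 'I_n) :
  (forall j, `|y 0 j| <= t) ->
  `|\det (colsub f (col_mx y X))| <= k.+1%:R * t * minors X.
Proof.
move=> yt; rewrite minor_col_mx; apply: le_trans (ler_norm_sum _ _ _) _.
apply: (@le_trans _ _ (\sum_(j < 1 + k) t * minors X)).
  apply: ler_sum => j _; rewrite normrM; apply: ler_pM => //.
  by rewrite normrM normrX normrN1 expr1n mul1r minor_le_minors.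
by rewrite sumr_const card_ord -mulrA mulr_natl.
Qed.

End Minors.

(** * Integer bases of rational subspaces *)

Section IntegerMatrices.
Context {R : realType}.
Local Notation toR Z := (map_mx (intr : int -> R) Z).

(** The rows span the row space of [Z] as soon as the columns [f] of [Z] are
    independent; up to a scalar factor this is the reduced echelon form. *)
Definition cramer_basis (e n : nat) (Z : 'M[int]_(e, n)) (f : 'I_e -> 'I_n) :
    'M[int]_(e, n) :=
  \adj (colsub f Z) *m Z.

Lemma cramer_basis_diag e n (Z : 'M[int]_(e, n)) f i j :
  cramer_basis Z f i (f j) = \det (colsub f Z) *+ (i == j).
Proof.
have := congr1 (fun M : 'M[int]_(e, e) => M i j) (mul_adj_mx (colsub f Z)).
by rewrite mxE [in RHS]mxE => <-; rewrite mxE; apply: eq_bigr => k _; rewrite !mxE.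
Qed.

(** Cramer's rule. The entries are thus Plücker coordinates of the row space of
    [Z], so that every rational subspace has a basis bounded by its height. *)
Lemma cramer_basisE e n (Z : 'M[int]_(e, n)) f i j :
  cramer_basis Z f i j = \det (colsub (fun k => if k == i then j else f k) Z).
Proof.
rewrite mxE (expand_det_col _ i); apply: eq_bigr => k _.
rewrite !mxE eqxx mulrC; congr (_ * _); rewrite /cofactor; congr (_ * \det _).
by apply/matrixP => a b; rewrite !mxE eq_sym (negbTE (neq_lift _ _)).
Qed.

Lemma toR_cramer e n (Z : 'M[int]_(e, n)) f :
  toR (cramer_basis Z f) = \adj (colsub f (toR Z)) *m toR Z.
Proof.
rewrite /cramer_basis map_mxM map_mx_adj; congr (\adj _ *m _).
by apply/matrixP => i j; rewrite !mxE.
Qed.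

Lemma colsub_toR k e n (Z : 'M[int]_(e, n)) (f : 'I_k -> 'I_n) :
  colsub f (toR Z) = toR (colsub f Z).
Proof. by apply/matrixP => i j; rewrite !mxE. Qed.

Lemma minor_toR e n (Z : 'M[int]_(e, n)) f :
  \det (colsub f (toR Z)) = (\det (colsub f Z))%:~R.
Proof. by rewrite colsub_toR det_map_mx. Qed.

Lemma norm_int_ge1 (z : int) : z != 0 -> 1 <= `|z%:~R : R|.
Proof. by move=> z0; rewrite -intr_norm ler1z; lia. Qed.

Lemma row_free_minor (F : fieldType) e n (M : 'M[F]_(e, n)) :
  row_free M -> exists f : 'I_e -> 'I_n, \det (colsub f M) != 0.
Proof.
rewrite -row_leq_rank => fM.
have fT : row_full M^T by rewrite /row_full mxrank_tr; rewrite eqn_leq rank_leq_row.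
exists (fullrankfun fT); rewrite -det_tr.
have -> : (colsub (fullrankfun fT) M)^T = rowsub (fullrankfun fT) M^T.
  by apply/matrixP => i j; rewrite !mxE.
by rewrite -unitfE -unitmxE; apply: fullrowsub_unit.
Qed.

Lemma cramer_basis_span e n (Z : 'M[int]_(e, n)) f :
  \det (colsub f Z) != 0 -> (toR (cramer_basis Z f) :=: toR Z)%MS.
Proof.
move=> D0; rewrite toR_cramer; apply: eqmxMfull.
rewrite row_full_unit unitmxE unitfE.
have : \det (\adj (colsub f (toR Z)) *m (colsub f (toR Z))) != 0.
  by rewrite mul_adj_mx det_scalar expf_neq0 // minor_toR intr_eq0.
by rewrite det_mulmx mulf_eq0 negb_or => /andP[].
Qed.

Lemma cramer_basis_le e n (Z : 'M[int]_(e, n)) f i j :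
  `|(cramer_basis Z f i j)%:~R| <= wedge_norm (toR Z).
Proof. by rewrite cramer_basisE -minor_toR; apply: minor_le_wedge. Qed.

Lemma wedge_ge1 e n (Z : 'M[int]_(e, n)) :
  row_free (toR Z) -> 1 <= wedge_norm (toR Z).
Proof.
move=> /row_free_minor[f]; rewrite minor_toR intr_eq0 => /norm_int_ge1.
by move=> /le_trans; apply; rewrite -minor_toR minor_le_wedge.
Qed.

Lemma mem_rows e n (M : 'M[R]_(e, n)) (x : 'rV[R]_n) :
  (x \in <<[tuple row i M | i < e]>>%VS) = (x <= M)%MS.
Proof.
apply/idP/submxP => [/coord_span ->|[c ->]].
  exists (\row_i coord [tuple row i M | i < e] i x).
  rewrite mulmx_sum_row; apply: eq_bigr => i _.
  by rewrite -tnth_nth tnth_mktuple mxE.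
rewrite mulmx_sum_row; apply: rpred_sum => i _; apply: rpredZ.
apply: memv_span; apply/tnthP; exists i; by rewrite tnth_mktuple.
Qed.

Lemma dim_rows e n (M : 'M[R]_(e, n)) :
  row_free M -> \dim <<[tuple row i M | i < e]>>%VS = e.
Proof.
move=> fM; suff /eqP -> : free [tuple row i M | i < e] by rewrite size_tuple.
apply/freeP => k k0 i.
have : (\row_i k i) *m M == 0.
  apply/eqP; rewrite -[RHS]k0 mulmx_sum_row; apply: eq_bigr => j _.
  by rewrite -tnth_nth tnth_mktuple mxE.
by rewrite mulmx_free_eq0 // => /eqP/rowP/(_ i); rewrite !mxE.
Qed.

Lemma rational_rows e n (V : 'M[int]_(e, n)) :
  row_free (toR V) ->
  rational_subspaces e <<[tuple row i (toR V) | i < e]>>%VS.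
Proof.
move=> fV; split; first exact: dim_rows.
exists [tuple row i (toR V) | i < e].
  rewrite basisEdim subvv /= dim_rows ?size_tuple ?card_ord //.
move=> x /tnthP[i ->] j; exists (V i j)%:~R.
by rewrite tnth_mktuple !mxE ratr_int.
Qed.

Lemma vspace_rows n (B : {vspace 'rV[R]_n}) e (X : e.-tuple 'rV[R]_n) x :
  basis_of B X -> (x \in B) = (x <= \matrix_(i < e) tnth X i)%MS.
Proof.
move=> bX; rewrite -mem_rows; congr (_ \in _).
rewrite -(span_basis bX); congr (<<_>>)%VS.
congr tval; apply: eq_from_tnth => i.
by rewrite tnth_mktuple rowK.
Qed.

Lemma rational_common_denominator e n (M : 'M[R]_(e, n)) :
  (forall i j, exists q : rat, M i j = ratr q) ->
  exists2 D : int, D != 0 & exists Z : 'M[int]_(e, n), D%:~R *: M = toR Z.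
Proof.
move=> Mq.
have /choice[q qP] : forall ij : 'I_e * 'I_n, exists q : rat, M ij.1 ij.2 = ratr q.
  by move=> ij; apply: Mq.
exists (\prod_ij denq (q ij)).
  by apply/prodf_neq0 => ij _; apply: denq_neq0.
exists (\matrix_(i, j) (numq (q (i, j)) * \prod_(kl | kl != (i, j)) denq (q kl))).
apply/matrixP => i j; rewrite !mxE (qP (i, j)) /ratr (bigD1 (i, j)) //= !intrM.
by field; rewrite intr_eq0 denq_neq0.
Qed.

(** In the Smith normal form [N = L D Q] of an integer matrix whose rows span
    [B], the first rows of the unimodular matrix [Q] are a basis of the lattice. *)
Lemma rational_Zbasis n e (B : {vspace 'rV[R]_n}) :
  rational_subspaces e B ->
  exists Z : 'M[int]_(e, n),
    [/\ row_free (toR Z), (forall x, (x \in B) = (x <= toR Z)%MS),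
      (forall v : 'rV[int]_n, toR v \in B -> exists u : 'rV[int]_e, v = u *m Z)
      & height B = wedge_norm (toR Z)].
Proof.
move=> [dB [X bX Xq]].
have sX : size X == e by rewrite -dB -(span_basis bX) eq_sym; exact: (basis_free bX).
pose tX := Tuple sX.
pose M := \matrix_(i < e) tnth tX i.
have BM x : (x \in B) = (x <= M)%MS by exact: vspace_rows.
have [|D D0 [N DM]] := @rational_common_denominator e n M.
  by move=> i j; rewrite mxE; apply: Xq; apply: (mem_tnth i tX).
have BN x : (x \in B) = (x <= toR N)%MS.
  rewrite BM -DM; have /eqmxP e1 : (D%:~R *: M :=: M)%MS.
    by apply: eqmx_scale; rewrite intr_eq0.
  by rewrite (eqmxP e1).
have eqB (P : 'M[R]_(e, n)) : (forall x, (x \in B) = (x <= P)%MS) -> row_free P.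
  move=> BP; rewrite -row_leq_rank.
  have fX : free tX by exact: (basis_free bX).
  have fM : row_free M.
    apply/inj_row_free => c; rewrite mulmx_sum_row => c0; apply/rowP => i.
    rewrite mxE; move/freeP: fX => /(_ (fun i => c 0 i)); apply.
    rewrite -[RHS]c0; apply: eq_bigr => j _; by rewrite rowK -tnth_nth.
  move: (fM); rewrite -row_leq_rank => /leq_trans; apply; apply: mxrankS.
  by apply/row_subP => i; rewrite -BP BM row_sub.
have fN := eqB _ BN.
have [L Lu [Q Qu [d _ NE]]] := int_Smith_normal_form N.
have en : (e <= n)%N by move: fN; rewrite -row_leq_rank => /leq_trans; apply; exact: rank_leq_col.
pose Z := (pid_mx e : 'M[int]_(e, n)) *m Q.
have NZ : N = (L *m diag_mx (\row_i d`_i)) *m Z.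
  rewrite NE /Z mulmxA; congr (_ *m _); rewrite -mulmxA; congr (_ *m _).
  apply/matrixP => i j; rewrite mul_diag_mx !mxE ltn_ord andbT.
  by case: eqP => _; rewrite ?mulr1 ?mulr0.
have NsZ : (toR N <= toR Z)%MS by rewrite NZ map_mxM submxMl.
have ZsN : (toR Z <= toR N)%MS.
  rewrite -(geq_leqif (mxrank_leqif_sup NsZ)).
  by move: fN; rewrite -row_leq_rank => /(leq_trans _); apply; exact: rank_leq_row.
have BZ x : (x \in B) = (x <= toR Z)%MS.
  by rewrite BN; apply/idP/idP => /submx_trans; apply.
have fZ := eqB _ BZ.
have intZ (v : 'rV[int]_n) : toR v \in B -> exists u : 'rV[int]_e, v = u *m Z.
  rewrite BZ => /submxP[c vE].
  pose w := v *m invmx Q.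
  have wE : toR w = c *m pid_mx e.
    rewrite map_mxM vE /Z map_mxM map_pid_mx -mulmxA -mulmxA -map_mxM mulmxV //.
    by rewrite map_mx1 mulmx1.
  exists (w *m pid_mx e).
  rewrite /Z mulmxA -(mulmxA w) pid_mx_id //.
  suff -> : w *m pid_mx e = w by rewrite /w mulmxKV.
  have : toR (w *m pid_mx e) = toR w.
    by rewrite map_mxM wE map_pid_mx -mulmxA pid_mx_id.
  by move=> /matrixP h; apply/matrixP => i j; have := h i j; rewrite !mxE => /intr_inj.
exists Z; split => //; subst e.
apply: height_Zbasis; split => [i|x [xB xint]].
  split; first by rewrite BZ row_sub.
  by move=> j; rewrite !mxE intr_int.
have /choice[v vP] : forall j, exists z : int, x 0 j = z%:~R.
  by move=> j; apply/intrP.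
have xE : x = toR (\row_j v j) by apply/rowP => j; rewrite !mxE.
have [|u uE] := intZ (\row_j v j); first by rewrite -xE.
exists u; split; first by rewrite -map_mxM -uE.
move=> u'; rewrite xE uE map_mxM => /(row_free_inj fZ) /rowP h.
by apply/rowP => j; have := h j; rewrite !mxE => /intr_inj.
Qed.

Lemma inord_shift (T : nat) (w : int) : (absz w <= T)%N ->
  ((inord (absz (w + T%:Z)) : 'I_(2 * T).+1) : nat)%:Z - T%:Z = w.
Proof.
move=> wT; have lt : (absz (w + T%:Z)%R < (2 * T).+1)%N by lia.
by rewrite inordK // gez0_abs; lia.
Qed.

(** Such a subspace has a Cramer basis with entries at most [h]. *)
Lemma finite_bounded_height n e (h : R) :
  finite_set [set B : {vspace 'rV[R]_n} | rational_subspaces e B /\ height B <= h].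
Proof.
pose T := `|Num.ceil h|%N.
pose dec (F : 'M['I_(2 * T).+1]_(e, n)) : 'M[int]_(e, n) :=
  \matrix_(i, j) ((F i j : nat)%:Z - T%:Z).
apply: (@sub_finite_set _ _ [set <<[tuple row i (toR (dec F)) | i < e]>>%VS
   | F in [set: 'M['I_(2 * T).+1]_(e, n)]]); last first.
  by apply: finite_image; apply: finite_finset.
move=> B [rB hB]; have [Z [fZ BZ _ hZ]] := rational_Zbasis rB.
have [f f0] := row_free_minor fZ.
rewrite minor_toR intr_eq0 in f0.
have bd i j : (`|cramer_basis Z f i j| <= T)%N.
  have := le_trans (cramer_basis_le Z f i j) (le_trans (eq_ind _ (fun x => x <= h) hB _ hZ) (ceil_ge h)).
  rewrite -intr_norm ler_int.
  by move: (cramer_basis Z f i j : int) => w; rewrite /T {T dec}; move: (Num.ceil h : int) => u; lia.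
exists (\matrix_(i, j) inord (absz (cramer_basis Z f i j + T%:Z)%R)) => //.
apply/vspaceP => x; rewrite mem_rows BZ -(cramer_basis_span f0).
congr (_ <= _)%MS; congr (map_mx _ _); apply/matrixP => i j.
by rewrite -[RHS](inord_shift (bd i j)) mxE; congr (Posz _ - _); rewrite mxE.
Qed.

End IntegerMatrices.

(** * Angles between lines and subspaces *)

Section Angle.
Context {R : realType} {n : nat}.
Implicit Types x y z : 'rV[R]_n.

Definition l1 x : R := \sum_i `|x 0 i|.

Lemma l1_ge0 x : 0 <= l1 x.
Proof. exact: sumr_ge0. Qed.

Lemma coord_le_l1 x i : `|x 0 i| <= l1 x.
Proof. by rewrite /l1 (bigD1 i) //= lerDl sumr_ge0. Qed.

Lemma l1_le x (t : R) : (forall i, `|x 0 i| <= t) -> l1 x <= n%:R * t.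
Proof.
move=> xt; apply: (le_trans (ler_sum _ (fun i _ => xt i))).
by rewrite sumr_const card_ord mulr_natl.
Qed.

Lemma l1D x y : l1 (x + y) <= l1 x + l1 y.
Proof.
by rewrite /l1 -big_split /=; apply: ler_sum => i _; rewrite mxE ler_normD.
Qed.

Lemma l1Z a x : l1 (a *: x) = `|a| * l1 x.
Proof. by rewrite /l1 mulr_sumr; apply: eq_bigr => i _; rewrite mxE normrM. Qed.

Lemma l1N x : l1 (- x) = l1 x.
Proof. by apply: eq_bigr => i _; rewrite mxE normrN. Qed.

Lemma l1_eq0 x : (l1 x == 0) = (x == 0).
Proof.
apply/idP/eqP => [|->]; last by rewrite /l1 big1 // => i _; rewrite mxE normr0.
rewrite psumr_eq0 // => /allP x0; apply/rowP => i.
by apply/eqP; rewrite mxE -normr_eq0; apply: x0; rewrite mem_index_enum.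
Qed.

Lemma l1_gt0 x : x != 0 -> 0 < l1 x.
Proof. by move=> x0; rewrite lt0r l1_eq0 x0 l1_ge0. Qed.

Lemma dot_ge0 x : 0 <= dot x x.
Proof. by apply: sumr_ge0 => i _; rewrite -expr2 sqr_ge0. Qed.

Lemma enorm_ge0 x : 0 <= enorm x.
Proof. exact: sqrtr_ge0. Qed.

Lemma enorm_le_l1 x : enorm x <= l1 x.
Proof.
rewrite -[leRHS](ger0_norm (l1_ge0 x)) -sqrtr_sqr; apply: ler_wsqrtr.
rewrite expr2 {2}/l1 mulr_sumr; apply: ler_sum => i _.
apply: le_trans (ler_norm _) _; rewrite normrM.
by apply: ler_wpM2r => //; apply: coord_le_l1.
Qed.

Lemma coord_le_enorm x i : `|x 0 i| <= enorm x.
Proof.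
rewrite -sqrtr_sqr; apply: ler_wsqrtr; rewrite /dot (bigD1 i) //= -expr2.
by rewrite lerDl; apply: sumr_ge0 => j _; rewrite -expr2 sqr_ge0.
Qed.

Lemma dot_eq0 x : (dot x x == 0) = (x == 0).
Proof.
apply/idP/eqP => [|->]; last by rewrite /dot big1 // => i _; rewrite mxE mul0r.
rewrite psumr_eq0 => [/allP x0|i _]; last by rewrite -expr2 sqr_ge0.
apply/rowP => i; apply/eqP; rewrite mxE -sqrf_eq0 expr2.
by apply: x0; rewrite mem_index_enum.
Qed.

Lemma enorm_gt0 x : x != 0 -> 0 < enorm x.
Proof. by move=> x0; rewrite sqrtr_gt0 lt0r dot_eq0 x0 dot_ge0. Qed.

Lemma det_pair x z (f : 'I_(1 + 1) -> 'I_n) :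
  \det (colsub f (col_mx x z)) = x 0 (f 0) * z 0 (f 1) - x 0 (f 1) * z 0 (f 0).
Proof.
have -> : colsub f (col_mx x z) =
    \matrix_(i < 2, j < 2) (if i == 0 then x 0 (f j) else z 0 (f j)).
  apply/matrixP => i j; rewrite !mxE; case: splitP => k; rewrite ord1 /= => ik.
    by rewrite (_ : i = 0) //; apply: val_inj.
  by rewrite (_ : i = 1) //; apply: val_inj.
rewrite (expand_det_row _ 0) big_ord_recl big_ord1 /cofactor !det_mx11 !mxE /=.
have -> : lift 0 0 = 1 :> 'I_2 by apply: val_inj.
have -> : lift 1 0 = 0 :> 'I_2 by apply: val_inj.
by rewrite addn0 expr0 expr1; ring.
Qed.

Lemma omega_ge0 x z : 0 <= omega x z.
Proof. by rewrite divr_ge0 ?wedge_norm_ge0 ?mulr_ge0 ?enorm_ge0. Qed.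

Lemma omega_scale a b x z : a != 0 -> b != 0 -> omega (a *: x) (b *: z) = omega x z.
Proof.
move=> a0 b0.
have en c y : enorm (c *: y) = `|c| * enorm y.
  rewrite -sqrtr_sqr -sqrtrM ?sqr_ge0 // /enorm /dot mulr_sumr.
  by congr Num.sqrt; apply: eq_bigr => i _; rewrite !mxE; ring.
have wn : wedge_norm (col_mx (a *: x) (b *: z)) = `|a * b| * wedge_norm (col_mx x z).
  rewrite -sqrtr_sqr -sqrtrM ?sqr_ge0 // /wedge_norm mulr_sumr.
  by congr Num.sqrt; apply: eq_bigr => t _; rewrite !det_pair !mxE; ring.
rewrite /omega wn !en normrM.
have [->|ex0] := eqVneq (enorm x) 0; first by rewrite !(mulr0, mul0r, invr0).
have [->|ez0] := eqVneq (enorm z) 0; first by rewrite !(mulr0, mul0r, invr0).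
field; by rewrite ?normr_eq0 ?a0 ?b0 ?ex0 ?ez0.
Qed.

Lemma omega_self x : omega x x = 0.
Proof.
rewrite /omega (_ : wedge_norm _ = 0) ?mul0r //.
rewrite /wedge_norm big1 ?sqrtr0 // => t _; rewrite det_pair; ring.
Qed.

(** Take for [s z] the point of the line of [z] with the same [i]-th coordinate
    as [x], where [i] is the largest coordinate of [z]: the other coordinates of
    [x - s z] are 2 x 2 minors divided by this largest coordinate. *)
Lemma omega_lower x z : z != 0 ->
  exists s, l1 (x - s *: z) <= n%:R ^+ 2 * omega x z * l1 x.
Proof.
move=> z0; have [x0|x0] := eqVneq x 0.
  by exists 0; rewrite x0 scale0r subrr (eqP (_ : l1 0 == 0)) ?mulr0 // l1_eq0.
have [i0 zi0] : exists i, z 0 i != 0.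
  apply/existsP; apply: contra_neqT z0; rewrite negb_exists => /forallP h.
  by apply/rowP => i; rewrite mxE; apply/eqP; have := h i; rewrite negbK.
pose i := [arg max_(i > i0) `|z 0 i|]%O.
have zmax j : `|z 0 j| <= `|z 0 i| by rewrite /i; case: arg_maxP => // k _; apply.
have zi : 0 < `|z 0 i| by apply: lt_le_trans (zmax i0); rewrite normr_gt0.
exists (x 0 i / z 0 i).
set w := wedge_norm (col_mx x z).
have le1 j : `|(x - (x 0 i / z 0 i) *: z) 0 j| <= w / `|z 0 i|.
  rewrite ler_pdivlMr // -normrM !mxE.
  have -> : (x 0 j - x 0 i / z 0 i * z 0 j) * z 0 i =
     x 0 j * z 0 i - x 0 i * z 0 j.
    by field; rewrite -normr_eq0 gt_eqF.
  have := minor_le_wedge (col_mx x z) (fun k : 'I_(1 + 1) => if k == 0 then j else i).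
  by rewrite det_pair.
apply: le_trans (l1_le le1) _.
have ez : enorm z <= n%:R * `|z 0 i|.
  by apply: le_trans (enorm_le_l1 _) _; apply: l1_le.
have wE : w = omega x z * (enorm x * enorm z).
  by rewrite /omega -/w divfK // mulf_neq0 ?gt_eqF ?enorm_gt0.
rewrite wE mulrA ler_pdivrMr //.
apply: (@le_trans _ _ (n%:R * (omega x z * (l1 x * (n%:R * `|z 0 i|))))).
  apply: ler_wpM2l => //; apply: ler_wpM2l; first exact: omega_ge0.
  by apply: ler_pM; rewrite ?enorm_ge0 ?enorm_le_l1.
by rewrite le_eqVlt; apply/orP; left; apply/eqP; ring.
Qed.

End Angle.

Section MinimalAngle.
Context {R : realType} {n : nat}.
Implicit Types x y z : 'rV[R]_n.

Lemma continuous_sum_fun (T : topologicalType) (I : finType) (P : pred I)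
    (F : I -> T -> R) :
  (forall i, continuous (F i)) -> continuous (fun w => \sum_(i | P i) F i w).
Proof.
move=> cF; apply: continuous_big => [|i _]; last exact: cF.
exact: add_continuous.
Qed.

Lemma continuous_mul_fun (T : topologicalType) (F G : T -> R) :
  continuous F -> continuous G -> continuous (fun w => F w * G w).
Proof. by move=> cF cG w; apply: cvgM; [apply: cF | apply: cG]. Qed.

Lemma continuous_sub_fun (T : topologicalType) (F G : T -> R) :
  continuous F -> continuous G -> continuous (fun w => F w - G w).
Proof. by move=> cF cG w; apply: cvgB; [apply: cF | apply: cG]. Qed.

Lemma closed_level (T : topologicalType) (F : T -> R) (c : R) :
  continuous F -> closed [set w | F w = c].
Proof.
move=> cF; apply: (@preimage_closed _ _ F [set c]) => [w _|]; first exact: cF.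
exact: closed_eq.
Qed.

(** By homogeneity both vectors may be taken on the unit spheres, which are
    compact. *)
Lemma omega_min_attained (A B : {vspace 'rV[R]_n}) : A != 0%VS -> B != 0%VS ->
  exists p : 'rV[R]_n * 'rV[R]_n,
    [/\ p.1 \in A, p.1 != 0, p.2 \in B, p.2 != 0 &
      forall x y, x \in A -> x != 0 -> y \in B -> y != 0 ->
        omega p.1 p.2 <= omega x y].
Proof.
move=> A0 B0.
pose MA := \matrix_(i < \dim A) tnth (vbasis A) i.
pose MB := \matrix_(i < \dim B) tnth (vbasis B) i.
have AP x : x \in A -> (x <= MA)%MS by rewrite -(vspace_rows x (vbasisP A)).
have PA x : (x <= MA)%MS -> x \in A by rewrite -(vspace_rows x (vbasisP A)).
have BP x : x \in B -> (x <= MB)%MS by rewrite -(vspace_rows x (vbasisP B)).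
have PB x : (x <= MB)%MS -> x \in B by rewrite -(vspace_rows x (vbasisP B)).
pose X (w : 'rV[R]_(n + n)) : 'rV[R]_n := lsubmx w.
pose Y (w : 'rV[R]_(n + n)) : 'rV[R]_n := rsubmx w.
have cX i : continuous (fun w => X w 0 i).
  rewrite (_ : (fun w => X w 0 i) = (fun w => w 0 (lshift n i))).
    exact: coord_continuous.
  by apply/funext => w; rewrite mxE.
have cY i : continuous (fun w => Y w 0 i).
  rewrite (_ : (fun w => Y w 0 i) = (fun w => w 0 (rshift n i))).
    exact: coord_continuous.
  by apply/funext => w; rewrite mxE.
pose K := [set w | dot (X w) (X w) = 1] `&` [set w | dot (Y w) (Y w) = 1] `&`
  (\bigcap_(i in [set: 'I_n]) [set w | (X w *m cokermx MA) 0 i = 0]) `&`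
  (\bigcap_(i in [set: 'I_n]) [set w | (Y w *m cokermx MB) 0 i = 0]).
have KP w : K w <-> [/\ X w \in A, dot (X w) (X w) = 1, Y w \in B & dot (Y w) (Y w) = 1].
  split=> [[[[dX dY] XA] YB]|[XA dX YB dY]].
    split => //; [apply: PA|apply: PB]; rewrite submxE; apply/eqP/rowP => i; rewrite [RHS]mxE.
      exact: XA.
    exact: YB.
  split; last by move=> i _ /=; have := BP _ YB; rewrite submxE => /eqP ->; rewrite mxE.
  split; last by move=> i _ /=; have := AP _ XA; rewrite submxE => /eqP ->; rewrite mxE.
  by split.
have Kcl : closed K.
  apply: closedI; [apply: closedI; [apply: closedI|]|].
  - by apply: closed_level; apply: continuous_sum_fun => i; apply: continuous_mul_fun; apply: cX.
  - by apply: closed_level; apply: continuous_sum_fun => i; apply: continuous_mul_fun; apply: cY.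
  - apply: closed_bigI => i _; apply: closed_level.
    rewrite (_ : (fun w => _) = (fun w => \sum_j X w 0 j * cokermx MA j i)).
      by apply: continuous_sum_fun => j; apply: continuous_mul_fun; [apply: cX|apply: cst_continuous].
    by apply/funext => w; rewrite mxE.
  - apply: closed_bigI => i _; apply: closed_level.
    rewrite (_ : (fun w => _) = (fun w => \sum_j Y w 0 j * cokermx MB j i)).
      by apply: continuous_sum_fun => j; apply: continuous_mul_fun; [apply: cY|apply: cst_continuous].
    by apply/funext => w; rewrite mxE.
have Kco : compact K.
  apply: subclosed_compact Kcl (@rV_compact _ _ (fun=> `[(-1 : R), 1]%classic) _) _.
    by move=> _; apply: segment_compact.
  move=> w /KP[_ dX _ dY] i /=; rewrite in_itv /= -ler_norml.
  case: (split_ordP i) => j ->.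
    by have := coord_le_enorm (X w) j; rewrite /enorm dX sqrtr1 mxE.
  by have := coord_le_enorm (Y w) j; rewrite /enorm dY sqrtr1 mxE.
pose F w := wedge_norm (col_mx (X w) (Y w)).
have cF : continuous F.
  move=> w; rewrite /F /wedge_norm.
  apply: (@continuous_comp _ _ _ (fun w => \sum_(t : (1 + 1).-tuple 'I_n |
     sorted ltn [seq val i | i <- t]) \det (colsub (tnth t) (col_mx (X w) (Y w))) ^+ 2)
     Num.sqrt); last exact: sqrt_continuous.
  move: w; apply: continuous_sum_fun => t.
  rewrite (_ : (fun w => _) = (fun w =>
    (X w 0 (tnth t 0) * Y w 0 (tnth t 1) - X w 0 (tnth t 1) * Y w 0 (tnth t 0)) *
    (X w 0 (tnth t 0) * Y w 0 (tnth t 1) - X w 0 (tnth t 1) * Y w 0 (tnth t 0)))).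
    by apply: continuous_mul_fun; apply: continuous_sub_fun;
      apply: continuous_mul_fun; by [apply: cX|apply: cY].
  by apply/funext => w; rewrite det_pair expr2.
have normalized x : x != 0 -> dot ((enorm x)^-1 *: x) ((enorm x)^-1 *: x) = 1.
  move=> x0; rewrite /dot; under eq_bigr => i _ do rewrite !mxE mulrACA.
  rewrite -mulr_sumr -/(dot x x) -(sqr_sqrtr (dot_ge0 x)) -/(enorm x).
  by field; rewrite gt_eqF // enorm_gt0.
have inK x y : x \in A -> x != 0 -> y \in B -> y != 0 ->
    K (row_mx ((enorm x)^-1 *: x) ((enorm y)^-1 *: y)).
  move=> xA x0 yB y0; apply/KP; rewrite /X /Y row_mxKl row_mxKr.
  by rewrite !rpredZ // !normalized.
have Fomega w : K w -> F w = omega (X w) (Y w).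
  by move=> /KP[_ dX _ dY]; rewrite /omega /enorm dX dY sqrtr1 mulr1 divr1.
have dot1_neq0 x : dot x x = 1 -> x != 0.
  by move=> dx; rewrite -dot_eq0 dx oner_eq0.
have [w0 wK wmin] : exists2 c, c \in K & forall t, t \in K -> F c <= F t.
  apply: compact_EVT_min => //; last by apply: continuous_subspaceT.
  exists (row_mx ((enorm (vpick A))^-1 *: vpick A) ((enorm (vpick B))^-1 *: vpick B)).
  by apply: inK; rewrite ?memv_pick // vpick0.
rewrite inE in wK; have /KP[XA dX YB dY] := wK.
exists (X w0, Y w0); split => //=; rewrite ?dot1_neq0 // => x y xA x0 yB y0.
have xyK := inK x y xA x0 yB y0.
have := wmin _ (mem_set xyK); rewrite (Fomega _ wK) (Fomega _ xyK) /X /Y row_mxKl row_mxKr.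
by rewrite omega_scale // invr_eq0 gt_eqF // enorm_gt0.
Qed.

(** The dimension condition makes [gdim] vanish, so that [psi 1] is the first
    angle; its definition by choice is meaningful since the minimum is attained. *)
Lemma psi1P (A B : {vspace 'rV[R]_n}) : A != 0%VS -> B != 0%VS ->
  (\dim A + \dim B <= n)%N ->
  (exists x y, [/\ x \in A, x != 0, y \in B, y != 0 & psi 1 A B = omega x y]) /\
  (forall x y, x \in A -> x != 0 -> y \in B -> y != 0 -> psi 1 A B <= omega x y).
Proof.
move=> A0 B0 AB.
have -> : psi 1 A B = omega_ 1 A B.
  by rewrite /psi /gdim (_ : (\dim A + \dim B - n = 0)%N) ?addn0 //; apply/eqP; rewrite subn_eq0.
rewrite /omega_ /= /omega_argmin.
have orthE (C : {vspace 'rV[R]_n}) x : orth_in C [::] x <-> x \in C.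
  by split=> [[]//|xC]; split.
case: xgetP => [p _ [/orthE p1A p10 /orthE p2B p20 pmin]|].
  split; first by exists p.1, p.2.
  by move=> x y xA x0 yB y0; apply: pmin => //; apply/orthE.
have [p [p1A p10 p2B p20 pmin]] := omega_min_attained A0 B0.
move=> /(_ p)[]; split; [exact/orthE|done|exact/orthE|done|].
by move=> x y /orthE xA x0 /orthE yB y0; apply: pmin.
Qed.

End MinimalAngle.

(** * Points avoiding the small values of multi-affine functions *)

Section Generic.
Context {R : realType}.

(** The intervals have total length at most 1/2, so they do not cover [0, 1]. *)
Lemma avoid_intervals (N : nat -> nat) (c : nat -> nat -> R) (rho : nat -> R) :
  (forall j, 0 <= rho j) ->
  (forall j, (N j)%:R * (2 * rho j) <= 2^-1 / (2 ^ j.+1)%:R) ->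
  exists2 x, 0 <= x <= 1 & forall j i, (i < N j)%N -> rho j < `|x - c j i|.
Proof.
move=> rho0 Nrho.
apply: contrapT => H.
pose I j i : set R := `[c j i - rho j, c j i + rho j]%classic.
pose F j : set R := \big[setU/set0]_(i < N j) I j i.
pose mu : set R -> \bar R := @lebesgue_measure R.
have mI j i : measurable (I j i) by exact: measurable_itv.
have mF j : measurable (F j) by apply: bigsetU_measurable.
have muI j i : mu (I j i) = (2 * rho j)%:E.
  rewrite /mu /I lebesgue_measure_itv /= lte_fin.
  case: ltP => [_|le]; first by rewrite -EFinB; congr (_%:E); ring.
  by rewrite (_ : rho j = 0) ?mulr0 //; have := rho0 j; lra.
have muF j : (mu (F j) <= 0 + (2^-1 / (2 ^ j.+1)%:R)%:E)%E.
  rewrite add0e; apply: (@le_trans _ _ (\sum_(i < N j) mu (I j i))%E).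
    by apply: (@Boole_inequality _ _ _ lebesgue_measure (I j)) => i _; apply: mI.
  under eq_bigr => i _ do rewrite muI.
  rewrite sumEFin lee_fin sumr_const card_ord -[leLHS]mulr_natl; exact: Nrho.
have cover : `[0, 1]%classic `<=` \bigcup_j F j.
  move=> x /=; rewrite in_itv /= => x01.
  apply: contrapT => xF; apply: H; exists x => // j i iN.
  rewrite ltNge; apply/negP => xc; apply: xF; exists j => //.
  rewrite /F -bigcup_mkord; exists i => //=.
  by rewrite /I /= in_itv /=; move: xc; rewrite ler_norml; lra.
have mu01 : mu `[0, 1]%classic = 1%E.
  by rewrite /mu lebesgue_measure_itv /= lte_fin ltr01 -EFinB subr0.
have : (mu `[0%R, 1%R]%classic <= (2^-1)%:E)%E.
  apply: (le_trans (measure_sigma_subadditive lebesgue_measure mF (measurable_itv _) cover)).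
  apply: (@le_trans _ _ (\sum_(0 <= j <oo) (0 + (2^-1 / (2 ^ j.+1)%:R)%:E))%E).
    by apply: lee_nneseries => // i _ _; apply: measure_ge0.
  apply: (le_trans (epsilon_trick xpredT _ _)) => //.
  by rewrite eseries0 // add0e.
by rewrite mu01 lee_fin; lra.
Qed.

(** If the affine function is smaller at some point of [0, 1] than half its value
    at [p], its slope is at least this value divided by [2 (Q + 1)]; so it is
    small only on a short interval. *)
Lemma small_affine_interval (u w p Q delta : R) :
  0 < delta <= 2^-1 -> 0 <= Q -> `|p| <= Q ->
  exists c, forall x, 0 <= x <= 1 ->
    4 * delta * (Q + 1) < `|x - c| ->
    delta * `|(1 - p) * u + p * w| <= `|(1 - x) * u + x * w|.
Proof.
move=> /andP[d0 d2] Q0 pQ.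
pose G x := (1 - x) * u + x * w.
have [[x0 [x0I Gx0]]|H] := pselect (exists x, (0 <= x <= 1) /\ `|G x| < delta * `|G p|); last first.
  (* the function is nowhere small on [0, 1]: no point has to be excluded *)
  exists 0 => x x01 _; rewrite leNgt; apply/negP => Gx; apply: H; by exists x.
exists x0 => x xI xx0; rewrite leNgt; apply/negP => Gx.
have Gp : 0 < `|G p|.
  by rewrite -(pmulr_rgt0 _ d0); apply: le_lt_trans Gx0.
have slope y z : G y - G z = (y - z) * (w - u) by rewrite /G; ring.
have s1 : `|G p| / 2 <= (Q + 1) * `|w - u|.
  have : `|G p - G x0| <= (Q + 1) * `|w - u|.
    rewrite slope normrM ler_wpM2r // (le_trans (ler_normB _ _)) // lerD //.
    by rewrite ger0_norm; lra.
  have := lerB_dist (G p) (G x0); have : delta * `|G p| <= 2^-1 * `|G p| by rewrite ler_wpM2r.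
  lra.
have s2 : `|x - x0| * `|w - u| < 2 * delta * `|G p|.
  rewrite -normrM -slope; apply: le_lt_trans (ler_normB _ _) _; move: Gx Gx0; rewrite -/(G x); lra.
have s3 : (4 * delta * (Q + 1)) * `|w - u| <= `|x - x0| * `|w - u|.
  by rewrite ler_wpM2r // ltW.
have : 4 * delta * (`|G p| / 2) <= 4 * delta * ((Q + 1) * `|w - u|).
  by rewrite ler_wpM2l // mulr_ge0 // ltW.
lra.
Qed.

Definition update (V : finType) (x : V -> R) v t := fun w => if w == v then t else x w.

Definition multiaffine (V : finType) (F : (V -> R) -> R) := forall x v t,
  F (update x v t) = (1 - t) * F (update x v 0) + t * F (update x v 1).

(** The coordinates of [p] are replaced by those of [x] one after the other. At
    each step the functions are affine in the new coordinate, so that each of them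
    excludes one short interval for it, and the factor [delta j] is lost; the
    functions come in finite families [T j] whose intervals have a summable total
    length. *)
Lemma generic_point (V : finType) (T : nat -> finType)
    (F : forall j, T j -> (V -> R) -> R) (p : forall j, T j -> V -> R)
    (Q delta : nat -> R) :
  (forall j, 0 < delta j <= 2^-1) -> (forall j, 0 <= Q j) ->
  (forall j t v, `|p j t v| <= Q j) ->
  (forall j t, multiaffine (F j t)) ->
  (forall j, #|T j|%:R * (2 * (4 * delta j * (Q j + 1))) <= 2^-1 / (2 ^ j.+1)%:R) ->
  exists2 x : V -> R, forall v, 0 <= x v <= 1 &
    forall j t, delta j ^+ #|V| * `|F j t (p j t)| <= `|F j t x|.
Proof.
move=> d0 Q0 pQ Faff card.
suff /(_ (enum V) (enum_uniq V))[x x01 Fx] : forall s : seq V, uniq s ->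
    exists2 x : V -> R, forall v, 0 <= x v <= 1 & forall j t,
      delta j ^+ size s * `|F j t (p j t)| <=
      `|F j t (fun v => if v \in s then x v else p j t v)|.
  exists x => // j t; have := Fx j t; rewrite -cardE.
  by rewrite (_ : (fun v => _) = x) //; apply/funext => v; rewrite mem_enum.
elim=> [_|v s IH /= /andP[vs us]].
  by exists (fun=> 0) => [v|j t]; rewrite ?lexx ?ler01 // expr0 mul1r.
have [x x01 Fx] := IH us.
pose mix j (t : T j) := fun w => if w \in s then x w else p j t w.
have /choice[c cP] : forall jt : {j : nat & T j}, exists c, forall y, 0 <= y <= 1 ->
    4 * delta (tag jt) * (Q (tag jt) + 1) < `|y - c| ->
    delta (tag jt) * `|(1 - p _ (tagged jt) v) * F _ (tagged jt) (update (mix _ (tagged jt)) v 0)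
      + p _ (tagged jt) v * F _ (tagged jt) (update (mix _ (tagged jt)) v 1)| <=
    `|(1 - y) * F _ (tagged jt) (update (mix _ (tagged jt)) v 0)
      + y * F _ (tagged jt) (update (mix _ (tagged jt)) v 1)|.
  by move=> [j t] /=; apply: small_affine_interval.
pose cc j i := if @insub nat _ 'I_#|T j| i is Some k then c (Tagged T (enum_val k)) else 0.
have [||y y01 yc] := @avoid_intervals (fun j => #|T j|) cc (fun j => 4 * delta j * (Q j + 1)).
- by move=> j; have := Q0 j; have /andP[/ltW] := d0 j; move=> *; rewrite !mulr_ge0 // addr_ge0.
- exact: card.
exists (fun w => if w == v then y else x w) => [w|j t].
  by case: eqP.
have -> : (fun w => if w \in v :: s then if w == v then y else x w else p j t w)
    = update (mix j t) v y.
  by apply/funext => w; rewrite /update /mix inE; case: eqP.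
have mixE : mix j t = update (mix j t) v (p j t v).
  by apply/funext => w; rewrite /update; case: eqP => // ->; rewrite /mix (negbTE vs).
rewrite Faff; apply: le_trans (cP (Tagged T t) y y01 _) => /=; last first.
  have := yc j (enum_rank t) (ltn_ord _).
  by rewrite /cc insubT // => ?; rewrite (_ : Sub _ _ = enum_rank t) ?enum_rankK //; apply: val_inj.
rewrite -Faff -mixE exprS -mulrA; apply: ler_wpM2l; first by case/andP: (d0 j) => /ltW.
exact: Fx.
Qed.

End Generic.

(** * Sequences of exponents with prescribed ratios *)

Section Growth.
Context {R : realType}.
Implicit Types (g : nat -> R).

(** The rounding up in [b (k + 1) ~ g k * b k] gives [g k * b k < b (k + 1)]; as
    [b 0 = 0], it also makes [b 1] positive. *)
Fixpoint expo g k : nat :=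
  if k is k'.+1 then (Num.truncn (g k' * (expo g k')%:R)).+1 else 0.

Definition window g k e : R := \prod_(k <= l < k + e) g l.

Lemma windowS g k e : window g k e.+1 = window g k e * g (k + e)%N.
Proof. by rewrite /window addnS big_nat_recr //= leq_addr. Qed.

Lemma windowSl g k e : window g k e.+1 = g k * window g k.+1 e.
Proof. by rewrite /window big_ltn ?addSnnS //; lia. Qed.

Lemma window0 g k : window g k 0 = 1.
Proof. by rewrite /window addn0 big_geq. Qed.

Lemma window_ge1 g k e : (forall l, 1 <= g l) -> 1 <= window g k e.
Proof.
move=> g1; elim: e => [|e IH]; first by rewrite window0.
by rewrite windowS; apply: mulr_ege1.
Qed.

Context (g : nat -> R) (G : R).
Hypothesis (g_ge2 : forall l, 2 <= g l) (g_leG : forall l, g l <= G).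
Local Notation b := (expo g).

Lemma g_ge0 l : 0 <= g l. Proof. by have := g_ge2 l; lra. Qed.

Lemma expo_gt k : g k * (b k)%:R < (b k.+1)%:R.
Proof. exact: truncnS_gt. Qed.

Lemma expo_le k : (b k.+1)%:R <= g k * (b k)%:R + 1.
Proof. by rewrite /= -natr1 lerD2r truncn_le mulr_ge0 // g_ge0. Qed.

Lemma expo_double k : (2 * b k < b k.+1)%N.
Proof.
rewrite -(@ltr_nat R) natrM; apply: le_lt_trans (expo_gt k).
by rewrite ler_wpM2r.
Qed.

Lemma expo_mono k l : (k <= l)%N -> (b k <= b l)%N.
Proof.
elim: l => [|l IH]; first by rewrite leqn0 => /eqP ->.
rewrite leq_eqVlt => /orP[/eqP -> //|]; rewrite ltnS => /IH.
by have := expo_double l; lia.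
Qed.

Lemma expo_ge_id k : (k <= b k)%N.
Proof. by elim: k => // k IH; have := expo_double k; lia. Qed.

Lemma expo_gap_ge k : (k < b k.+1 - b k)%N.
Proof. by have := expo_double k; have := expo_ge_id k; lia. Qed.

Lemma expo_gap_mono k l : (k <= l)%N -> (b k.+1 - b k <= b l.+1 - b l)%N.
Proof.
elim: l => [|l IH]; first by rewrite leqn0 => /eqP ->.
rewrite leq_eqVlt => /orP[/eqP -> //|]; rewrite ltnS => /IH.
by have := expo_double l; have := expo_double l.+1; lia.
Qed.

Lemma expo_window_ge k e : window g k e * (b k)%:R <= (b (k + e))%:R.
Proof.
elim: e => [|e IH]; first by rewrite window0 mul1r addn0.
rewrite windowS addnS; apply: le_trans (ltW (expo_gt _)).
by rewrite mulrAC mulrC ler_wpM2l // g_ge0.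
Qed.

Lemma expo_window_le e : exists K : nat, forall k,
  (b (k + e))%:R <= window g k e * (b k)%:R + K%:R.
Proof.
elim: e => [|e [K IH]].
  by exists 0%N => k; rewrite window0 mul1r addn0 addr0.
have [K' K'P] : exists K' : nat, G * K%:R + 1 <= K'%:R.
  by exists (Num.truncn (G * K%:R + 1)).+1; apply: ltW (truncnS_gt _).
exists K' => k; rewrite windowS addnS; apply: le_trans (expo_le _) _.
have := ler_wpM2l (g_ge0 (k + e)) (IH k).
have : g (k + e)%N * K%:R <= G * K%:R by apply: ler_wpM2r.
set u := (b (k + e))%:R; set v := (b k)%:R; set w := window g k e.
have -> : w * g (k + e)%N * v = g (k + e)%N * (w * v) by ring.
by rewrite mulrDr; lra.
Qed.

(** The scale [k] attached to a height [h]: past it, the consecutive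
    denominators [2 ^ b l] are further apart than [h], while [2 ^ b (k + e)]
    is still at most a power of [h]. *)
Lemma scale_of_height (kappa C0 : R) (e : nat) :
  0 <= kappa -> 1 <= C0 ->
  (forall k, window g k.+1 e * (b k.+1)%:R <= kappa * ((b k.+1)%:R - (b k)%:R)) ->
  exists2 C, 0 < C & forall h, 1 <= h -> exists k,
    (forall l, (k <= l)%N -> C0 * h * 2 ^+ b l <= 2 ^+ b l.+1) /\
    2 ^+ b (k + e) <= C * h `^ kappa.
Proof.
move=> k0 C01 kP; have [K KP] := expo_window_le e.
pose C := 2 ^+ b e + 2 ^+ K * C0 `^ kappa.
have C0k : 0 <= 2 ^+ K * C0 `^ kappa by rewrite mulr_ge0 ?exprn_ge0 ?powR_ge0.
exists C => [|h h1]; first by rewrite ltr_wpDr // exprn_gt0.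
have hk : 1 <= h `^ kappa by rewrite -(powRr0 h) ler_powR.
have C0h : 0 <= C0 * h by rewrite mulr_ge0 //; lra.
have ex : exists k, C0 * h <= 2 ^+ (b k.+1 - b k).
  exists (Num.truncn (C0 * h)).+1.
  apply: le_trans (ltW (truncnS_gt _)) _.
  set t := (Num.truncn _).+1.
  rewrite -natrX ler_nat; apply: leq_trans (ltnW (ltn_expl t (ltnSn 1))) _.
  by rewrite leq_exp2l // ltnW // expo_gap_ge.
pose k := ex_minn ex.
have big l : (k <= l)%N -> C0 * h * 2 ^+ b l <= 2 ^+ b l.+1.
  rewrite /k; case: ex_minnP => k' kk' _ kl.
  rewrite -[in leRHS](@subnK (b l) (b l.+1)); last by have := expo_double l; lia.
  rewrite exprD ler_wpM2r ?exprn_ge0 //; apply: le_trans kk' _.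
  by rewrite ler_eXn2l ?expo_gap_mono //; lra.
exists k; split=> //.
(* [k = 0] is possible, and then [h] is not bounded below by any gap *)
rewrite /k; case: ex_minnP => -[_ _|k' _ kmin].
  rewrite add0n; apply: (@le_trans _ _ (2 ^+ b e * h `^ kappa)).
    by rewrite ler_peMr // exprn_ge0.
  by rewrite ler_wpM2r ?powR_ge0 // lerDl.
have small : 2 ^+ (b k'.+1 - b k') <= C0 * h.
  rewrite leNgt; apply/negP => /ltW /kmin; by rewrite ltnn.
have bk : (b k' <= b k'.+1)%N by have := expo_double k'; lia.
apply: (@le_trans _ _ (2 ^+ K * C0 `^ kappa * h `^ kappa)); last first.
  by rewrite ler_wpM2r ?powR_ge0 // lerDr exprn_ge0.
rewrite -mulrA -powRM; [|lra|lra].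
rewrite -[leLHS]powR_mulrn; last by lra.
apply: (@le_trans _ _ (2 `^ (K%:R + kappa * ((b k'.+1)%:R - (b k')%:R)))).
  rewrite ler_powR ?ler1n //; have := KP k'.+1; have := kP k'; lra.
rewrite powRD; last by apply/implyP => _; rewrite gt_eqF //; lra.
rewrite powR_mulrn; last by lra.
rewrite ler_wpM2l ?exprn_ge0 // mulrC powRrM.
apply: ge0_ler_powR => //; rewrite ?nnegrE ?powR_ge0 //.
by rewrite -natrB // powR_mulrn //; lra.
Qed.

Lemma expo_window_powR e : exists2 C : R, 0 < C & forall k,
  2 ^+ b (k + e) <= C * (2 ^+ b k) `^ window g k e.
Proof.
have [K KP] := expo_window_le e; exists (2 ^+ K) => [|k]; first by rewrite exprn_gt0.
rewrite -!powR_mulrn; [|lra..].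
rewrite -powRrM -powRD; last by apply/implyP => _; rewrite gt_eqF //; lra.
by rewrite ler_powR ?ler1n // mulrC addrC mulrC; have := KP k; rewrite (mulrC (window _ _ _)).
Qed.

Lemma expo_window_powR_ge k e : (2 ^+ b k) `^ window g k e <= (2 ^+ b (k + e) : R).
Proof.
rewrite -!powR_mulrn; [|lra..].
by rewrite -powRrM mulrC; rewrite ler_powR ?ler1n // expo_window_ge.
Qed.

(** The numerical condition of [scale_of_height] for the exponent [mu - 1];
    it is here that [g k >= 1 + golden ratio], that is [g k ^ 2 - 3 g k + 1 >= 0],
    is used. *)
Lemma window_gap_sharp mu e k :
  0 <= g k ^+ 2 - 3 * g k + 1 -> window g k e.+1 <= mu ->
  window g k.+1 e * (b k.+1)%:R <= (mu - 1) * ((b k.+1)%:R - (b k)%:R).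
Proof.
rewrite windowSl => gk gmu; set P := window _ _ _ in gmu *.
have P1 : 1 <= P by apply: window_ge1 => l; have := g_ge2 l; lra.
have := expo_gt k; set x := (b k.+1)%:R; set y := (b k)%:R => xy.
have y0 : 0 <= y by [].
have g2 := g_ge2 k; set c := g k in gk gmu xy g2 *.
have cx : 0 <= x - y by nra.
apply: (@le_trans _ _ ((c * P - 1) * (x - y))); last by rewrite ler_wpM2r //; lra.
have x0 : 0 <= x by lra.
have h1 : (c - 1) * x <= c * (x - y) by lra.
have cP : 0 <= c * P - 1 by nra.
have h2 : (c * P - 1) * ((c - 1) * x) <= (c * P - 1) * (c * (x - y)) by rewrite ler_wpM2l.
have h3 : c * P <= (c * P - 1) * (c - 1) by nra.
have h4 : c * P * x <= (c * P - 1) * (c - 1) * x by rewrite ler_wpM2r.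
rewrite -(@ler_pM2l _ c); lra.
Qed.

(** When all the ratios are at least [gmin], the approximants past the scale of a
    height are bounded by a small power of this height. *)
Lemma window_gap_crude mu gmin e k :
  2 <= gmin -> gmin <= g k -> window g k e.+1 <= mu ->
  window g k.+1 e * (b k.+1)%:R <= (mu / (gmin - 1)) * ((b k.+1)%:R - (b k)%:R).
Proof.
rewrite windowSl => gm2 gmk gmu; set P := window _ _ _ in gmu *.
have P1 : 1 <= P by apply: window_ge1 => l; have := g_ge2 l; lra.
have := expo_gt k; set x := (b k.+1)%:R; set y := (b k)%:R => xy.
have y0 : 0 <= y by [].
have g2 := g_ge2 k; set c := g k in gmk gmu xy g2 *.
have x0 : 0 <= x by nra.
have cx : 0 <= x - y by nra.
rewrite mulrAC ler_pdivlMr; last by lra.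
apply: (@le_trans _ _ (c * P * (x - y))); last by rewrite ler_wpM2r.
have h1 : (gmin - 1) * x <= c * (x - y) by nra.
have : P * ((gmin - 1) * x) <= P * (c * (x - y)) by rewrite ler_wpM2l //; lra.
lra.
Qed.

End Growth.

(** * The target vector and its integer approximants *)

Section Approximants.
Context {R : realType} (m : nat) (g : nat -> R).
Hypothesis (m_gt0 : (0 < m)%N) (g_ge2 : forall l, 2 <= g l).
Local Notation toR Z := (map_mx (intr : int -> R) Z).
Local Notation b := (expo g).
Local Notation q k := (2 ^+ b k : R).

Lemma intr_pow2 k : (2 ^+ k : int)%:~R = 2 ^+ k :> R.
Proof. by rewrite rmorphXn. Qed.

(** The coordinates other than the first one, in cyclic order. *)
Definition cyc (k : nat) : 'I_m.+1 := inord (k %% m).+1.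

Lemma cyc_val k : cyc k = (k %% m).+1 :> nat.
Proof. by rewrite inordK // ltnS ltn_mod. Qed.

Lemma cyc_neq0 k : cyc k != 0.
Proof. by rewrite -val_eqE /= cyc_val. Qed.

Lemma cyc_inj k i j : (i < m)%N -> (j < m)%N ->
  (cyc (k + i) == cyc (k + j)) = (i == j).
Proof.
move=> im jm; rewrite -val_eqE /= !cyc_val eqSS eqn_modDl.
by rewrite !modn_small.
Qed.

Fixpoint approx k : 'rV[int]_m.+1 :=
  if k is k'.+1 then 2 ^+ (b k - b k') *: approx k' + delta_mx 0 (cyc k')
  else delta_mx 0 0.

Lemma approxS k :
  approx k.+1 = 2 ^+ (b k.+1 - b k) *: approx k + delta_mx 0 (cyc k).
Proof. by []. Qed.

Lemma expo_leS k : (b k <= b k.+1)%N.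
Proof. by have := expo_double g_ge2 k; lia. Qed.

Lemma approx_first k : approx k 0 0 = 2 ^+ b k.
Proof.
elim: k => [|k IH]; first by rewrite mxE eqxx.
rewrite approxS !mxE IH eqxx eq_sym (negbTE (cyc_neq0 k)) addr0 -exprD.
by rewrite subnK // expo_leS.
Qed.

Definition slope k i : R := (approx k 0 i)%:~R / q k.

Lemma approx_slope k i : (approx k 0 i)%:~R = q k * slope k i.
Proof. by rewrite /slope mulrC divfK // expf_neq0. Qed.

Lemma slopeS k i : slope k.+1 i = slope k i + (i == cyc k)%:R / q k.+1.
Proof.
rewrite /slope approxS !mxE eqxx intrD intrM intr_pow2 mulrDl.
congr (_ + _); last by case: eqP.
rewrite -[in X in _ / X](@subnK (b k) (b k.+1)) ?expo_leS // exprD.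
by rewrite -mulf_div divff ?mul1r // expf_neq0.
Qed.

Lemma q_gt0 k : 0 < q k. Proof. by rewrite exprn_gt0. Qed.
Lemma q_ge1 k : 1 <= q k. Proof. by rewrite exprn_ege1 //; lra. Qed.

Lemma q_double k : 2 * q k <= q k.+1.
Proof. by rewrite -exprS ler_eXn2l ?ltr1n //; have := expo_double g_ge2 k; lia. Qed.

Lemma slope_mono k l i : (k <= l)%N -> slope k i <= slope l i.
Proof.
elim: l => [|l IH]; first by rewrite leqn0 => /eqP ->.
rewrite leq_eqVlt => /orP[/eqP -> //|]; rewrite ltnS => /IH /le_trans; apply.
by rewrite slopeS lerDl divr_ge0 // ltW // q_gt0.
Qed.

(** The upper bounds decrease because the denominators at least double. *)
Lemma slope_upper k l i : (k <= l)%N -> slope l i + 2 / q l.+1 <= slope k i + 2 / q k.+1.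
Proof.
elim: l => [|l IH]; first by rewrite leqn0 => /eqP ->.
rewrite leq_eqVlt => /orP[/eqP -> //|]; rewrite ltnS => /IH; apply: le_trans.
rewrite slopeS -addrA lerD2l -[leRHS]divr1 .
have h : (i == cyc l)%:R / q l.+1 <= 1 / q l.+1.
  by rewrite ler_pM2r ?invr_gt0 ?q_gt0 //; case: eqP.
have : 2 / q l.+2 <= 1 / q l.+1.
  by rewrite ler_pdivrMr ?q_gt0 // mulrAC ler_pdivlMr ?q_gt0 // mul1r q_double.
by rewrite divr1; move: h; lra.
Qed.

(** The common limit of the adjacent sequences of [slope_mono] and
    [slope_upper], coordinate by coordinate. *)
Definition target : 'rV[R]_m.+1 := \row_i sup (range (fun k => slope k i)).

Lemma slope_ubound k i : ubound (range (fun l => slope l i)) (slope k i + 2 / q k.+1).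
Proof.
move=> _ [l _ <-]; have [kl|/ltnW lk] := leqP k l.
  by apply: le_trans (slope_upper _ kl); rewrite lerDl divr_ge0 // ltW // q_gt0.
by apply: le_trans (slope_mono _ lk) _; rewrite lerDl divr_ge0 // ltW // q_gt0.
Qed.

Lemma target_ge k i : slope k i <= target 0 i.
Proof.
rewrite mxE; apply: ub_le_sup; last by exists k.
by exists (slope 0 i + 2 / q 1); exact: slope_ubound.
Qed.

Lemma target_le k i : target 0 i <= slope k i + 2 / q k.+1.
Proof.
by rewrite mxE; apply: ge_sup; [exists (slope 0 i); exists 0%N|exact: slope_ubound].
Qed.

(** At step [l] the coordinate [cyc l] increases by [1 / 2 ^ b (l + 1)]. *)
Lemma target_gap k l : (k <= l)%N -> slope k (cyc l) + 1 / q l.+1 <= target 0 (cyc l).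
Proof.
move=> kl; apply: le_trans (target_ge l.+1 _); rewrite slopeS eqxx lerD2r.
exact: slope_mono.
Qed.

Lemma target_first : target 0 0 = 1.
Proof.
have s1 k : slope k 0 = 1 by rewrite /slope approx_first intr_pow2 divff // expf_neq0.
apply/eqP; rewrite eq_le -{2}(s1 0%N) target_ge andbT mxE.
by apply: ge_sup; [exists (slope 0 0); exists 0%N|move=> _ [k _ <-]; rewrite s1].
Qed.

Lemma slope0_ge0 k i : 0 <= slope k i.
Proof.
apply: le_trans (slope_mono i (leq0n k)).
by rewrite /slope mxE divr_ge0 ?(ltW (q_gt0 _)) //; case: (_ && _).
Qed.

Lemma slope_le3 k i : slope k i <= 3.
Proof.
apply: le_trans (slope_mono i (leqnSn k)) _.
have : slope k.+1 i + 2 / q k.+2 <= slope 0 i + 2 / q 1 by apply: slope_upper.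
have : 0 <= 2 / q k.+2 by rewrite divr_ge0 // ltW // q_gt0.
have : 2 / q 1 <= 2.
  by rewrite ler_pdivrMr ?q_gt0 // ler_peMr // q_ge1.
have : slope 0 i <= 1 by rewrite /slope mxE expr0 divr1; case: (_ && _).
lra.
Qed.

Lemma target_approx k i :
  `|q k * target 0 i - (approx k 0 i)%:~R| <= 2 * q k / q k.+1.
Proof.
rewrite approx_slope -mulrBr normrM gtr0_norm ?q_gt0 // [2 * _]mulrC -mulrA.
rewrite ler_pM2l ?q_gt0 // ger0_norm ?subr_ge0 ?target_ge //.
by rewrite lerBlDl target_le.
Qed.

(** A basis of the lattice spanned by [approx k], ..., [approx (k + e)]:
    consecutive approximants differ by a unit vector modulo the previous one. *)
Definition frame k e : 'M[int]_(e.+1, m.+1) :=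
  \matrix_(i < e.+1) if i == 0 :> nat then approx k else delta_mx 0 (cyc (k + i.-1)).

Lemma frame_sub k e p (W : 'M[R]_(p, m.+1)) :
  (forall i, (i <= e)%N -> (toR (approx (k + i)) <= W)%MS) ->
  (toR (frame k e) <= W)%MS.
Proof.
move=> XW; apply/row_subP => i; rewrite -map_row rowK.
case: eqP => [_|/eqP]; first by have := XW 0%N isT; rewrite addn0.
case: i => -[//|i] /= ie _.
have -> : delta_mx 0 (cyc (k + i)) = approx (k + i.+1) - 2 ^+ (b (k + i).+1 - b (k + i)) *: approx (k + i).
  by rewrite addnS approxS addrC addKr.
rewrite map_mxB map_mxZ; apply: addmx_sub; first by apply: XW.
by rewrite eqmx_opp; apply: scalemx_sub; apply: XW; apply: ltnW.
Qed.

Definition frame_cols k e c (j : 'I_e.+1) : 'I_m.+1 :=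
  if j == 0 :> nat then c else cyc (k + j.-1).

(** The columns [cyc k], ..., [cyc (k + e - 1)] carry the unit rows, so the minor
    is triangular. *)
Lemma frame_minor k e c : (e <= m)%N -> (forall i, (i < e)%N -> c != cyc (k + i)) ->
  \det (colsub (@frame_cols k e c) (frame k e)) = approx k 0 c.
Proof.
move=> em cP; rewrite -det_tr det_trig /frame_cols.
  rewrite big_ord_recl big1 ?mulr1; first by rewrite !mxE.
  by move=> i _; rewrite !mxE /= ?mxE ?eqxx.
apply/is_trig_mxP => i j ij; rewrite !mxE; case: eqP => [j0|_]; first by move: ij; rewrite j0.
rewrite !mxE eqxx /=; case: j ij => -[//|j] /= je ij.
case: i ij => -[|i] /= ie ij; first by rewrite (negbTE (cP _ _)) //; lia.
rewrite ltnS in ij; rewrite ltnS in ie; rewrite ltnS in je.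
rewrite cyc_inj ?(leq_trans _ em) //; move: ij; rewrite ltn_neqAle => /andP[/negbTE -> _]; rewrite mulr0n //.
Qed.

Lemma frame_free k e : (e <= m)%N -> row_free (toR (frame k e)).
Proof.
move=> em; apply/inj_row_free => c c0.
have ncyc i : (i < e)%N -> 0 != cyc (k + i) by rewrite eq_sym cyc_neq0.
pose f := @frame_cols k e 0.
have d0 : \det (colsub f (toR (frame k e))) != 0.
  by rewrite minor_toR frame_minor // approx_first intr_pow2 expf_neq0.
have := colsub_mul c (toR (frame k e)) f; rewrite c0.
have -> : colsub f (0 : 'rV[R]_m.+1) = 0 by apply/matrixP => i j; rewrite !mxE.
move/esym/eqP; rewrite mulmx_free_eq0 ?row_free_unit ?unitmxE ?unitfE //.
by move/eqP.
Qed.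

Lemma approx_odd k : odd (absz (approx k.+1 0 (cyc k))).
Proof.
have gap : (0 < b k.+1 - b k)%N by have := expo_double g_ge2 k; lia.
rewrite approxS !mxE !eqxx; case: (b k.+1 - b k)%N gap => // a _.
by rewrite exprS -mulrA; move: (2 ^+ a * _) => z; lia.
Qed.

(** The frame spans a primitive lattice: among its maximal minors are a power
    of 2 and, as the last coordinate to have changed is odd, an odd number. *)
Lemma frame_primitive k e (U : 'M[int]_e.+1) (Z : 'M[int]_(e.+1, m.+1)) :
  (e < m)%N -> frame k e = U *m Z -> absz (\det U) = 1%N.
Proof.
move=> em UZ.
have divU c : (forall i, (i < e)%N -> c != cyc (k + i)) ->
    (absz (\det U) %| absz (approx k 0%R c))%N.
  move=> cP; rewrite -(frame_minor (ltnW em) cP) UZ colsub_mul det_mulmx abszM.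
  exact: dvdn_mulr.
have d2 : (absz (\det U) %| 2 ^ b k)%N.
  have := divU 0; rewrite approx_first abszX; apply=> i _.
  by rewrite eq_sym cyc_neq0.
case: k UZ divU d2 => [|k] UZ divU d2; first by apply/eqP; rewrite -dvdn1.
apply/eqP; rewrite -dvdn1.
have dodd : (absz (\det U) %| absz (approx k.+1 0%R (cyc k)))%N.
  apply: divU => i ie; rewrite addSnnS -{1}(addn0 k) cyc_inj //; lia.
have /eqP <- : coprime (2 ^ b k.+1) (absz (approx k.+1 0 (cyc k))).
  by rewrite coprimeXl // prime_coprime // dvdn2 approx_odd.
by rewrite dvdn_gcd d2 dodd.
Qed.

Lemma approx_sub_frame k e : (toR (approx (k + e)) <= toR (frame k e))%MS.
Proof.
have sub i : (i <= e)%N -> (toR (approx (k + i)) <= toR (frame k e))%MS.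
  elim: i => [|i IH] ie.
    apply: submx_trans (row_sub 0 _); rewrite -map_row rowK eqxx addn0.
    exact: submx_refl.
  rewrite addnS approxS map_mxD map_mxZ; apply: addmx_sub.
    by apply: scalemx_sub; apply: IH; apply: ltnW.
  have ie' : (i.+1 < e.+1)%N by [].
  apply: submx_trans (row_sub (Ordinal ie') _); rewrite -map_row rowK /=.
  exact: submx_refl.
exact: sub.
Qed.

End Approximants.

(** * Wedge products of the target with integer matrices *)

Section Completion.

(** Steinitz exchange: as long as a row is left, the independent ones do not span
    the whole space, so they miss a unit vector. *)
Lemma complete_rows (F : fieldType) (k N : nat) (M : 'M[F]_(k, N)) (S : {set 'I_k}) :
  (k <= N)%N ->
  (forall c : 'rV_k, (forall i, i \notin S -> c 0 i = 0) -> c *m M = 0 -> c = 0) ->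
  exists T : 'I_k -> 'I_N,
    row_free (\matrix_i (if i \in S then row i M else delta_mx 0 (T i))).
Proof.
move=> kN; have [n nS] := ubnP #|~: S|; elim: n S M nS => // n IH S M nS fM.
have [ST|/existsP[i iS]] := boolP ([forall i, i \in S]).
  have f : 'I_k -> 'I_N by exact: widen_ord kN.
  exists f; rewrite (_ : \matrix_i _ = M).
    by apply/inj_row_free => c; apply: fM => i; rewrite (forallP ST i).
  by apply/row_matrixP => i; rewrite rowK (forallP ST i).
pose MS := \matrix_j (if j \in S then row j M else 0) : 'M[F]_(k, N).
have [t tMS] : exists t, ~~ ((delta_mx 0 t : 'rV_N) <= MS)%MS.
  apply/existsP; rewrite -negb_forall; apply/negP => /forallP H.
  have : row_full MS.
    rewrite -sub1mx; apply/row_subP => t; rewrite row1; exact: H.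
  rewrite /row_full => /eqP rMS.
  have : row_free MS by rewrite -row_leq_rank rMS.
  move=> fMS; have : (delta_mx 0 i : 'rV[F]_k) *m MS == 0.
    by rewrite -rowE rowK (negbTE iS).
  by rewrite mulmx_free_eq0 // => /eqP/rowP/(_ i)/eqP; rewrite !mxE !eqxx oner_eq0.
pose M1 := \matrix_j (if j == i then delta_mx 0 t else row j M).
have mulE (c : 'rV[F]_k) : (forall j, j \notin i |: S -> c 0 j = 0) ->
    c *m M1 = c 0 i *: delta_mx 0 t + c *m MS.
  move=> cS; rewrite !mulmx_sum_row (bigD1 i) //= rowK eqxx; congr (_ + _).
  rewrite [RHS](bigD1 i) //= rowK (negbTE iS) scaler0 add0r.
  apply: eq_bigr => j ji; rewrite !rowK (negbTE ji); case: ifP => // jS.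
  by rewrite cS ?scale0r // !inE negb_or ji jS.
have [||T fT] := IH (i |: S) M1.
- have /proper_card : ~: (i |: S) \proper ~: S; last by lia.
  apply/properP; split; last by exists i; rewrite !inE ?eqxx.
  by apply/fintype.subsetP => x; rewrite !inE negb_or => /andP[].
- move=> c cS; rewrite mulE // => c0.
  have ci : c 0 i = 0.
    apply: contraNeq tMS => ci; apply/submxP; exists (- (c 0 i)^-1 *: c).
    move/eqP: c0; rewrite addr_eq0 => /eqP /(congr1 (fun v => (c 0 i)^-1 *: v)).
    by rewrite scalerA mulVf // scale1r => ->; rewrite scalerN -scalemxAl scaleNr.
  apply: fM => [j jS|].
    have [-> //|ji] := eqVneq j i; by apply: cS; rewrite !inE negb_or ji jS.
  move: c0; rewrite ci scale0r add0r => <-; rewrite !mulmx_sum_row.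
  apply: eq_bigr => j _; rewrite rowK; case: ifP => // jS.
  have [->|ji] := eqVneq j i; first by rewrite ci !scale0r.
  by rewrite cS ?scale0r // !inE negb_or ji jS.
exists (fun j => if j == i then t else T j).
congr (row_free _) : fT; apply/row_matrixP => j; rewrite !rowK !inE.
by have [->|ji] := eqVneq j i; rewrite ?(negbTE iS) // rowK ?eqxx ?(negbTE ji).
Qed.

Lemma row_free_col_mx (F : fieldType) k N (u : 'rV[F]_N) (V : 'M[F]_(k, N)) :
  row_free V -> ~~ (u <= V)%MS -> row_free (col_mx u V).
Proof.
move=> fV uV; apply/inj_row_free => w.
rewrite -[w]hsubmxK mul_row_col; set a := lsubmx w; set c := rsubmx w.
rewrite [a]mx11_scalar mul_scalar_mx => ac0.
have a0 : a 0 0 = 0.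
  apply: contraNeq uV => a0; apply/submxP; exists (- (a 0 0)^-1 *: c).
  move/eqP: ac0; rewrite addr_eq0 => /eqP /(congr1 (fun v => (a 0 0)^-1 *: v)).
  by rewrite scalerA mulVf // scale1r => ->; rewrite scalerN -scalemxAl scaleNr.
move/eqP: ac0; rewrite a0 scale0r add0r mulmx_free_eq0 // => /eqP ->.
by rewrite raddf0 row_mx0.
Qed.

End Completion.

Section Wedge.
Context {R : realType} (m : nat) (g : nat -> R).
Hypothesis (m_gt0 : (0 < m)%N) (g_ge2 : forall l, 2 <= g l).
Local Notation toR Z := (map_mx (intr : int -> R) Z).
Local Notation q k := (2 ^+ expo g k : R).

(** The [e + 1] approximants are independent, so a space of dimension [e] cannot
    contain them all. *)
Lemma approx_outside k e p (W : 'M[R]_(p, m.+1)) : (e <= m)%N -> (\rank W <= e)%N ->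
  exists2 i, (i <= e)%N & ~~ (toR (approx m g (k + i)) <= W)%MS.
Proof.
move=> em rW; apply: contrapT => H.
have : (toR (frame m g k e) <= W)%MS.
  apply: frame_sub => i ie; apply: contrapT => /negP iW; apply: H; by exists i.
move/mxrankS; have /eqP -> := frame_free m_gt0 g_ge2 k em; lia.
Qed.

(** An integer vector [approx l] outside the lattice spanned by [V] has a
    nonzero integral wedge product with it; as [2 ^ b l * target] is very close
    to [approx l], its wedge product with [V] is still at least 1/2. *)
Lemma target_wedge_ge l e (V : 'M[int]_(e, m.+1)) :
  row_free (toR (col_mx (approx m g l) V)) ->
  4 * e.+1%:R * minors (toR V) * q l <= q l.+1 ->
  exists f, (2 * q l)^-1 <= `|\det (colsub f (col_mx (target m g) (toR V)))|.
Proof.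
move=> fXV small; have [f] := row_free_minor fXV; rewrite minor_toR intr_eq0 => /(@norm_int_ge1 R).
rewrite -minor_toR map_col_mx => one.
exists f; set y := target m g.
have qy : q l *: y = 1 *: toR (approx m g l) + (q l *: y - toR (approx m g l)).
  by rewrite scale1r addrC subrK.
have := minor_col_mx_lin (q l) y 0 (toR V) f.
rewrite addr0 {1}qy minor_col_mx_lin mul1r => E.
have z0 : \det (colsub f (col_mx (0 : 'rV[R]_m.+1) (toR V))) = 0.
  by rewrite minor_col_mx big1 // => j _; rewrite mxE mul0r.
rewrite z0 addr0 in E.
have ql := q_gt0 g l; have ql1 := q_gt0 g l.+1.
have err : `|\det (colsub f (col_mx (q l *: y - toR (approx m g l)) (toR V)))| <= 2^-1.
  apply: le_trans (minor_col_mx_le (t := 2 * q l / q l.+1) _ f _) _.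
    by move=> j; rewrite !mxE; have := target_approx m_gt0 g_ge2 l j; rewrite mxE.
  have -> : e.+1%:R * (2 * q l / q l.+1) * minors (toR V) =
     2^-1 * (4 * e.+1%:R * minors (toR V) * q l) / q l.+1.
    by field; rewrite gt_eqF.
  by rewrite ler_pdivrMr // ler_pM2l // invr_gt0.
set D := \det (colsub f (col_mx y (toR V))) in E *.
have : 2^-1 <= q l * `|D|.
  rewrite -[X in X * `|D|]gtr0_norm // -normrM -E.
  set u := \det _ in one E *; set v := \det _ in err E *.
  by have := lerB_dist u (- v); rewrite opprK normrN; lra.
by rewrite invfM ler_pdivrMr // [_ * q l]mulrC.
Qed.

End Wedge.

(** * A generic graph *)

Section GenericGraph.
Context {R : realType} (m r : nat).
Local Notation n := (m.+1 + r)%N.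
Local Notation toR Z := (map_mx (intr : int -> R) Z).

(** The projection of the rows of [Z] on the first [m.+1] coordinates along the
    row space of [row_mx eta 1%:M]. *)
Definition project e (eta : 'M[R]_(r, m.+1)) (Z : 'M[R]_(e, n)) : 'M[R]_(e, m.+1) :=
  lsubmx Z - rsubmx Z *m eta.

Lemma projectE e eta (Z : 'M[R]_(e, n)) i j :
  project eta Z i j = Z i (lshift r j) - \sum_l Z i (rshift m.+1 l) * eta l j.
Proof. by rewrite !mxE; congr (_ - _); apply: eq_bigr => l _; rewrite !mxE. Qed.

Lemma project_mul e k eta (c : 'M[R]_(k, e)) (Z : 'M[R]_(e, n)) :
  project eta (c *m Z) = c *m project eta Z.
Proof.
rewrite /project mulmxBr mulmxA.
by rewrite -[Z in LHS]hsubmxK mul_mx_row row_mxKl row_mxKr.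
Qed.

Lemma projectB_scale eta (s : R) (x z : 'rV[R]_n) :
  project eta (x - s *: z) = project eta x - s *: project eta z.
Proof.
have lE : lsubmx (x - s *: z) = lsubmx x - s *: lsubmx z.
  by apply/matrixP => i j; rewrite !mxE.
have rE : rsubmx (x - s *: z) = rsubmx x - s *: rsubmx z.
  by apply/matrixP => i j; rewrite !mxE.
by rewrite /project lE rE mulmxBl -scalemxAl; apply/rowP => j; rewrite !mxE; ring.
Qed.

Definition graph_minor (y : 'rV[R]_m.+1) e (Z : 'M[R]_(e, n)) (f : 'I_(1 + e) -> 'I_m.+1)
    (eta : 'M[R]_(r, m.+1)) : R :=
  \det (colsub f (col_mx y (project eta Z))).

Definition mx_of (x : 'I_r * 'I_m.+1 -> R) : 'M[R]_(r, m.+1) := \matrix_(l, j) x (l, j).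

(** A coordinate of [eta] occurs in a single column, affinely. *)
Lemma graph_minor_multiaffine y e (Z : 'M[R]_(e, n)) f :
  multiaffine (fun x => graph_minor y Z f (mx_of x)).
Proof.
move=> x [l0 j0] t; rewrite /graph_minor.
pose N s := colsub f (col_mx y (project (mx_of (update x (l0, j0) s)) Z)).
rewrite -/(N t) -/(N 0) -/(N 1).
have Naff a i : N t a i = (1 - t) * N 0 a i + t * N 1 a i.
  rewrite !mxE; case: splitP => k _; first by ring.
  rewrite !projectE.
  have -> : \sum_l Z k (rshift m.+1 l) * mx_of (update x (l0, j0) t) l (f i) =
    (1 - t) * (\sum_l Z k (rshift m.+1 l) * mx_of (update x (l0, j0) 0) l (f i)) +
    t * (\sum_l Z k (rshift m.+1 l) * mx_of (update x (l0, j0) 1) l (f i)).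
    rewrite !mulr_sumr -big_split /=; apply: eq_bigr => l _; rewrite !mxE /update.
    by case: eqP => _; ring.
  by ring.
have Nconst s a i : f i != j0 -> N s a i = N t a i.
  move=> fi; rewrite !mxE; case: splitP => k _ //.
  rewrite !projectE; congr (_ - _); apply: eq_bigr => l _; rewrite !mxE /update.
  by rewrite xpair_eqE (negbTE fi) andbF.
have [injf|/injectivePn[i [j ij fij]]] := boolP (injectiveb f); last first.
  have d0 s : \det (N s) = 0.
    by rewrite -det_tr; apply: (determinant_alternate ij) => k; rewrite !mxE fij.
  by rewrite !d0 !mulr0 addr0.
move/injectiveP in injf.
have [/existsP[i0 /eqP fi0]|/existsPn nf] := boolP [exists i, f i == j0]; last first.
  have Nt s : N s = N t by apply/matrixP => a i; apply: Nconst.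
  by rewrite !Nt; ring.
rewrite -[\det (N t)]det_tr -[\det (N 0)]det_tr -[\det (N 1)]det_tr.
apply: (determinant_multilinear (i0 := i0)).
- by apply/rowP => a; have := Naff a i0; rewrite !mxE.
- apply/matrixP => k a; rewrite ![row' _ _ _ _]mxE ![_^T _ _]mxE; apply: Nconst.
  by rewrite -fi0 (inj_eq injf) eq_sym neq_lift.
- apply/matrixP => k a; rewrite ![row' _ _ _ _]mxE ![_^T _ _]mxE; apply: Nconst.
  by rewrite -fi0 (inj_eq injf) eq_sym neq_lift.
Qed.

(** The exponent lost in [generic_graph]: [m n + 2] for each entry of [eta], since
    there are about [X ^ (m n)] matrices with entries at most [X]. *)
Definition generic_loss : nat := ((m * n + 2) * (r * m.+1))%N.

(** The minors are sorted into finite families by the dyadic size [2 ^ j] of the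
    entries of [Z]. The threshold [tau] stands for the largest value of the
    minor on the box of the [p]: the minor is compared to a point where it is at
    least [tau], if there is one. *)
Lemma generic_graph (y : 'rV[R]_m.+1) (tau : nat -> nat -> R) : (0 < m)%N ->
  (forall e j, 0 <= tau e j) ->
  exists2 eta : 'M[R]_(r, m.+1), forall l j, 0 <= eta l j <= 1 &
  exists2 c : R, 0 < c & forall e j (Z : 'M[int]_(e, n)) f (p : 'M[R]_(r, m.+1)), (e <= m)%N ->
    (forall a b, (absz (Z a b) <= 2 ^ j)%N) ->
    (forall l b, `|p l b| <= m%:R * (2 ^+ j + 1)) ->
    tau e j <= `|graph_minor y (toR Z) f p| ->
    c / (2 ^+ j) ^+ generic_loss * tau e j <= `|graph_minor y (toR Z) f eta|.
Proof.
move=> m0 tau0.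
pose I j : finType := {e : 'I_m.+1 &
  ('M['I_(2 * 2 ^ j).+1]_(e, n) * {ffun 'I_(1 + e) -> 'I_m.+1})%type}.
pose dec j e (F : 'M['I_(2 * 2 ^ j).+1]_(e, n)) : 'M[int]_(e, n) :=
  \matrix_(a, b) ((F a b : nat)%:Z - (2 ^ j)%N%:Z).
pose G j (t : I j) x := graph_minor y (toR (dec j _ (tagged t).1)) (tagged t).2 (mx_of x).
pose box j := [set p : 'I_r * 'I_m.+1 -> R | forall v, `|p v| <= m%:R * (2 ^+ j + 1)].
pose pt j (t : I j) : 'I_r * 'I_m.+1 -> R :=
  xget (fun=> 0) [set p | box j p /\ tau (tag t) j <= `|G j t p|].
(* [C X ^ (m n)] bounds the number of minors of size [X = 2 ^ j] *)
pose C : R := (m.+1 * ((3 ^ (m * n)) * m.+1 ^ m.+1))%N%:R.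
have C0 : 0 < C by rewrite ltr0n !muln_gt0 !expn_gt0.
pose k : R := (96 * m%:R * C)^-1.
have m1 : 1 <= m%:R :> R by rewrite ler1n.
have C1 : 1 <= C by rewrite ler1n -(ltr0n R).
have mC : 1 <= m%:R * C by apply: mulr_ege1.
have k0 : 0 < k by rewrite invr_gt0; lra.
have k2 : k <= 2^-1 by rewrite /k lef_pV2 ?posrE; lra.
have p2 j : 1 <= 2 ^+ j :> R by rewrite exprn_ege1 //; lra.
pose delta j : R := k / (2 ^+ j) ^+ (m * n + 2).
pose Q j : R := m%:R * (2 ^+ j + 1).
have Q0 j : 0 <= Q j by rewrite mulr_ge0 // addr_ge0 // exprn_ge0.
have cardI j : #|I j|%:R <= C * (2 ^+ j) ^+ (m * n) :> R.
  have -> : C * (2 ^+ j) ^+ (m * n) = (m.+1 * ((3 * 2 ^ j) ^ (m * n) * m.+1 ^ m.+1))%N%:R.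
    by rewrite /C expnMn !natrM !natrX; ring.
  rewrite ler_nat card_tagged sumnE big_map big_enum /=.
  apply: (@leq_trans (\sum_(e < m.+1) (3 * 2 ^ j) ^ (m * n) * m.+1 ^ m.+1)); last first.
    by rewrite sum_nat_const card_ord.
  apply: leq_sum => e _; rewrite card_prod card_mx card_ffun !card_ord.
  have p2j : (0 < 2 ^ j)%N by rewrite expn_gt0.
  have em : (e <= m)%N by rewrite -ltnS.
  apply: leq_mul; last by rewrite leq_pexp2l //; lia.
  apply: (@leq_trans ((3 * 2 ^ j) ^ (e * n))%N).
    case: (posnP (e * n)%N) => [-> //|en]; rewrite leq_exp2r //; lia.
  by rewrite leq_pexp2l ?muln_gt0 // leq_mul2r em orbT.
have [|||||x x01 xP] := @generic_point R ('I_r * 'I_m.+1)%type I G pt Q delta.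
- move=> j; apply/andP; split; first by rewrite divr_gt0 // exprn_gt0 // exprn_gt0.
  apply: le_trans k2; rewrite ler_pdivrMr ?exprn_gt0 // ler_peMr ?(ltW k0) //.
  by rewrite exprn_ege1.
- exact: Q0.
- move=> j t v; rewrite /pt; case: xgetP => [p _ [pb _]|_]; first exact: pb.
  by rewrite normr0.
- by move=> j t; apply: graph_minor_multiaffine.
- move=> j; set X : R := 2 ^+ j.
  have X1 : 1 <= X := p2 j; have X0 : 0 < X by lra.
  apply: (@le_trans _ _ (C * X ^+ (m * n) * (2 * (4 * delta j * (3 * m%:R * X))))).
    apply: ler_pM => //.
    - by rewrite !mulr_ge0 ?addr_ge0 ?Q0 ?divr_ge0 ?(ltW k0) ?exprn_ge0 ?(ltW X0).
    - rewrite !ler_pM2l ?mulr_gt0 ?divr_gt0 ?exprn_gt0 ?X0 //.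
      rewrite /Q -/X; have := ler_pM ler01 ler01 m1 X1; rewrite mulr1 => mX.
      have : m%:R <= m%:R * X by rewrite ler_peMr //; lra.
      lra.
  rewrite /delta -/X addn2 !exprS /k natrX exprS -/X.
  rewrite le_eqVlt; apply/orP; left; apply/eqP; field.
  by rewrite !gt_eqF ?exprn_gt0 // ?X0; lra.
exists (mx_of x) => [l j|]; first by rewrite mxE.
exists (k ^+ (r * m.+1)) => [|e j Z f p em Zj pj pt_ge]; first by rewrite exprn_gt0.
have em' : (e < m.+1)%N by rewrite ltnS.
pose t : I j := Tagged (fun e : 'I_m.+1 => ('M['I_(2 * 2 ^ j).+1]_(e, n) * {ffun 'I_(1 + e) -> 'I_m.+1})%type)
  (i := Ordinal em') (\matrix_(a, b) inord (absz (Z a b + (2 ^ j)%N%:Z)%R), finfun f).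
have GE (u : 'I_r * 'I_m.+1 -> R) : G j t u = graph_minor y (toR Z) f (mx_of u).
  rewrite /G /graph_minor /=; congr (\det _).
  have -> : dec j e (\matrix_(a, b) inord (absz (Z a b + (2 ^ j)%N%:Z)%R)) = Z.
    apply/matrixP => a b; rewrite -[RHS](inord_shift (Zj a b)) mxE.
    by congr (Posz _ - _); rewrite mxE.
  by apply/matrixP => a b; rewrite !mxE ffunE.
have := xP j t; rewrite (GE x); apply: le_trans.
have -> : delta j ^+ #|{: 'I_r * 'I_m.+1}| =
    k ^+ (r * m.+1) / (2 ^+ j) ^+ generic_loss.
  by rewrite card_prod !card_ord /delta expr_div_n /generic_loss (exprM _ (m * n + 2)%N).
rewrite ler_wpM2l //.
  by rewrite divr_ge0 ?exprn_ge0 ?(ltW k0).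
rewrite /pt; case: xgetP => [u _ [_ tu]|]; first exact: tu.
move=> /(_ (fun v => p v.1 v.2)) []; split => [v|]; first exact: pj.
rewrite GE (_ : mx_of _ = p) //; by apply/matrixP => a b; rewrite mxE.
Qed.

End GenericGraph.

(** * Subspaces not contained in the first factor: a good value of the graph *)

Section SkewSubspaces.
Context {R : realType} (m r : nat) (g : nat -> R).
Hypothesis (m_gt0 : (0 < m)%N) (g_ge2 : forall l, 2 <= g l).
Context (G : R).
Hypothesis g_leG : forall l, g l <= G.
Local Notation n := (m.+1 + r)%N.
Local Notation toR Z := (map_mx (intr : int -> R) Z).
Local Notation q k := (2 ^+ expo g k : R).

(** A Cramer basis adapted to the decomposition: choosing the nonzero minor with
    as many columns as possible among the last [r] ones, the rows that are not
    normalized there vanish there. *)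
Lemma adapted_cramer_basis e (Z : 'M[int]_(e, n)) :
  row_free (toR Z) -> rsubmx Z != 0 ->
  exists f : 'I_e -> 'I_n, [/\ \det (colsub f Z) != 0,
    (forall i j, (f i < m.+1)%N -> cramer_basis Z f i (rshift m.+1 j) = 0) &
    exists i, (m.+1 <= f i)%N].
Proof.
move=> fZ Z2.
have [f0 d0] := row_free_minor fZ; rewrite minor_toR intr_eq0 in d0.
pose P (f : {ffun 'I_e -> 'I_n}) := \det (colsub f Z) != 0.
pose N (f : {ffun 'I_e -> 'I_n}) := #|[pred i | (m.+1 <= f i)%N]|.
have P0 : P (finfun f0).
  rewrite /P (_ : colsub _ Z = colsub f0 Z) //.
  by apply/matrixP => i j; rewrite !mxE ffunE.
have [f Pf fmax] := arg_maxnP N P0.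
have van i j : (f i < m.+1)%N -> cramer_basis Z f i (rshift m.+1 j) = 0.
  move=> fi; rewrite cramer_basisE; apply/eqP; apply/negPn/negP => d.
  pose f' : {ffun 'I_e -> 'I_n} := [ffun k => if k == i then rshift m.+1 j else f k].
  have Pf' : P f'.
    rewrite /P (_ : colsub _ Z = colsub (fun k => if k == i then rshift m.+1 j else f k) Z) //.
    by apply/matrixP => a b; rewrite !mxE ffunE.
  have le : (N f' <= N f)%N := fmax _ Pf'.
  move: le; rewrite leqNgt => /negP; apply; apply: proper_card.
  apply/properP; split; last first.
    exists i; rewrite !inE ?ffunE ?eqxx /= ?leq_addr //; by rewrite -leqNgt.
  by apply/fintype.subsetP => k; rewrite !inE ffunE; case: eqP => //= _; rewrite leq_addr.
exists f; split => //; apply: contrapT => H.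
have Z'0 : rsubmx (toR (cramer_basis Z f)) = 0.
  apply/matrixP => i j; rewrite 2![LHS]mxE van ?[RHS]mxE // ltnNge; apply/negP => fi; apply: H; by exists i.
have : (toR Z <= toR (cramer_basis Z f))%MS by rewrite (cramer_basis_span Pf).
move=> /submxP[D DE]; case/eqP: Z2.
have : rsubmx (toR Z) = 0.
  rewrite DE -[toR (cramer_basis Z f)]hsubmxK Z'0 mul_mx_row mulmx0.
  by rewrite row_mxKr.
by move=> /matrixP h; apply/matrixP => i j; have := h i j; rewrite !mxE => /eqP; rewrite intr_eq0 => /eqP.
Qed.

(** [complete_rows] applied to [u] and the rows of [M] indexed by [S]. *)
Lemma row_free_masked e (M : 'M[R]_(e, m.+1)) (S : {set 'I_e}) (u : 'rV[R]_m.+1) :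
  (forall c : 'rV_e, (forall i, i \notin S -> c 0 i = 0) -> c *m M = 0 -> c = 0) ->
  ~~ (u <= \matrix_i (if i \in S then row i M else 0))%MS -> (e < m.+1)%N ->
  exists T : 'I_e -> 'I_m.+1,
    row_free (col_mx u (\matrix_i (if i \in S then row i M else delta_mx 0 (T i)))).
Proof.
move=> fM uM em.
pose S1 : {set 'I_(1 + e)} := lshift e 0 |: [set rshift 1 i | i in S].
have inS1 i : (rshift 1 i \in S1) = (i \in S).
  by rewrite in_setU1 eq_rlshift /= mem_imset //; apply: rshift_inj.
have [|c cS c0|T fT] := @complete_rows R (1 + e) m.+1 (col_mx u M) S1; first by [].
  have cR i : i \notin S -> c 0 (rshift 1 i) = 0 by move=> iS; apply: cS; rewrite inS1.
  rewrite -[c]hsubmxK mul_row_col in c0 *.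
  set a := lsubmx c in c0 *; set c' := rsubmx c in c0 *.
  rewrite [a]mx11_scalar mul_scalar_mx in c0.
  have c'S i : i \notin S -> c' 0 i = 0 by move=> iS; rewrite mxE cR.
  have a0 : a 0 0 = 0.
    apply: contraNeq uM => a0; apply/submxP; exists (- (a 0 0)^-1 *: c').
    move/eqP: c0; rewrite addr_eq0 => /eqP /(congr1 (fun v => (a 0 0)^-1 *: v)).
    rewrite scalerA mulVf // scale1r => ->; rewrite scalerN -scalemxAl scaleNr.
    congr (- (_ *: _)); rewrite !mulmx_sum_row; apply: eq_bigr => i _; rewrite rowK.
    by case: ifP => // /negbT /c'S ->; rewrite !scale0r.
  rewrite a0 scale0r add0r in c0.
  rewrite (fM c' c'S c0) [a]mx11_scalar a0 -scalemx1 scale0r.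
  by rewrite row_mx0.
exists (fun i => T (rshift 1 i)); congr (row_free _) : fT.
apply/row_matrixP => i; rewrite rowK; case: (split_ordP i) => k ->.
  by rewrite ord1 !inE eqxx /= rowKu row_id; apply/rowP => j; rewrite mxE col_mxEu.
by rewrite inS1 [in RHS]rowKd rowK; case: ifP => // _; rewrite rowKd.
Qed.

(** The point [p] at which the generic [eta] is compared: there the projection
    of the Cramer basis is made of its rows without last coordinates and of
    unit vectors, chosen so as to be independent of a good approximant [approx l]
    of the target; this gives an integral, hence large, wedge product. *)
Lemma skew_witness (e : nat) (kappa : R) : (e < m)%N -> 0 <= kappa ->
  (forall k, window g k.+1 e * (expo g k.+1)%:R <=
     kappa * ((expo g k.+1)%:R - (expo g k)%:R)) ->
  exists2 c : R, 0 < c & forall Z : 'M[int]_(e.+1, n),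
    row_free (toR Z) -> rsubmx Z != 0 ->
    exists Z' : 'M[int]_(e.+1, n), exists f, exists p : 'M[R]_(r, m.+1),
      [/\ (toR Z' :=: toR Z)%MS,
          forall i j, `|(Z' i j)%:~R| <= wedge_norm (toR Z),
          forall l j, `|p l j| <= m%:R * (wedge_norm (toR Z) + 1) &
          c * wedge_norm (toR Z) `^ (- (e.+1%:R * kappa))
            <= `|graph_minor (target m g) (toR Z') f p|].
Proof.
move=> em k0 kP.
pose C2 : R := (m.+1 ^ e.+1)%:R * (e.+1)`!%:R.
have C2_1 : 1 <= C2.
  by rewrite /C2 -natrM ler1n muln_gt0 expn_gt0 fact_gt0.
pose C0 : R := 4 * e.+2%:R * C2.
have C0_1 : 1 <= C0.
  by apply: mulr_ege1 => //; apply: mulr_ege1; rewrite ?ler1n //; lra.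
have [C Cgt0 CP] := scale_of_height g_ge2 g_leG k0 C0_1 kP.
exists ((2 * C)^-1) => [|Z fZ Z2]; first by rewrite invr_gt0 mulr_gt0 //; lra.
set h := wedge_norm (toR Z); have h1 : 1 <= h := wedge_ge1 fZ.
have h0 : 0 <= h by lra.
have [f [d0 van [i0 fi0]]] := adapted_cramer_basis fZ Z2.
pose Z' := cramer_basis Z f.
have Z'h i j : `|(Z' i j)%:~R| <= h by apply: cramer_basis_le.
pose S : {set 'I_e.+1} := [set i | (f i < m.+1)%N]%SET.
have i0S : i0 \notin S by rewrite inE -leqNgt.
have [k [kbig kq]] := CP (h ^+ e.+1) (exprn_ege1 _ h1).
pose M := lsubmx (toR Z').
have fZ' : row_free (toR Z').
  by rewrite -row_leq_rank (cramer_basis_span d0) row_leq_rank.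
have fM (c : 'rV_e.+1) : (forall i, i \notin S -> c 0 i = 0) -> c *m M = 0 -> c = 0.
  move=> cS cM; apply/eqP; rewrite -(mulmx_free_eq0 _ fZ') -[toR Z']hsubmxK mul_mx_row cM.
  apply/eqP; rewrite (_ : c *m _ = 0) ?row_mx0 //; apply/rowP => j; rewrite [LHS]mxE [RHS]mxE.
  apply: big1 => i _; have [iS|iS] := boolP (i \in S); last by rewrite cS ?mul0r.
  by rewrite 2!mxE van ?mulr0 //; rewrite inE in iS.
pose MS := \matrix_i (if i \in S then row i M else 0).
have rMS : (\rank MS <= e)%N.
  rewrite -ltnS ltn_neqAle rank_leq_row andbT; apply/negP => fMS.
  have : (delta_mx 0 i0 : 'rV[R]_e.+1) *m MS == 0 by rewrite -rowE rowK (negbTE i0S).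
  rewrite mulmx_free_eq0 // => /eqP/rowP/(_ i0)/eqP.
  by rewrite !mxE !eqxx oner_eq0.
have [i ie Xi] := approx_outside m_gt0 g_ge2 k (ltnW em) rMS.
have [|T fT] := row_free_masked fM Xi _; first by rewrite ltnS.
pose W : 'M[int]_(e.+1, m.+1) :=
  \matrix_i (if i \in S then row i (lsubmx Z') else delta_mx 0 (T i)).
have WE : toR W = \matrix_i (if i \in S then row i M else delta_mx 0 (T i)).
  apply/row_matrixP => a; rewrite -map_row !rowK; case: ifP => _.
    by rewrite map_row; congr (row _ _); apply/matrixP => u v; rewrite !mxE.
  by rewrite map_delta_mx.
have Wh a b : `|toR W a b| <= h.
  rewrite WE mxE; case: ifP => _; first by rewrite 3!mxE Z'h.
  by rewrite mxE; case: (_ && _); rewrite ?normr1 ?normr0.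
have minW : minors (toR W) <= C2 * h ^+ e.+1.
  rewrite /C2 -mulrA; apply: minors_le_const => f'.
  apply: le_trans (det_le (rho := fun=> h) _) _; first by move=> a b; rewrite mxE Wh.
  by rewrite prodr_const card_ord.
have fXW : row_free (toR (col_mx (approx m g (k + i)) W)) by rewrite map_col_mx WE.
have [|f' f'P] := target_wedge_ge m_gt0 g_ge2 fXW.
  apply: le_trans (kbig (k + i)%N (leq_addr _ _)).
  rewrite ler_wpM2r ?(ltW (q_gt0 _ _)) // /C0 -[leRHS]mulrA ler_wpM2l // mulr_ge0 //; lra.
pose D : R := (\det (colsub f Z))%:~R.
have D1 : 1 <= `|D| by apply: norm_int_ge1.
pose y : 'M[R]_(e.+1, m.+1) := M - toR W.
have yE a b : y a b =
    if a \in S then 0 else (Z' a (lshift r b))%:~R - (b == T a)%:R.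
  rewrite /y WE mxE [X in _ + X]mxE [X in - X]mxE; case: ifP => _.
    by rewrite [row _ _ _ _]mxE subrr.
  by rewrite 2!mxE [delta_mx _ _ _ _]mxE eqxx.
(* in the columns [f i] the Cramer basis is [D] times the identity, so that
   subtracting [p] moves each row by the prescribed amount [y] *)
pose p : 'M[R]_(r, m.+1) :=
  \matrix_(l, j) \sum_i ((f i == rshift m.+1 l)%:R * (y i j / D)).
exists Z', f', p; split => //.
- exact: cramer_basis_span.
- move=> l j; rewrite mxE; apply: le_trans (ler_norm_sum _ _ _) _.
  apply: (@le_trans _ _ (\sum_(i < e.+1) (h + 1))).
    apply: ler_sum => i' _; rewrite !normrM normfV.
    apply: (@le_trans _ _ (1 * (`|y i' j| / 1))).
      apply: ler_pM => //.
        by case: eqP; rewrite ?normr1 ?normr0.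
      by rewrite ler_wpM2l // lef_pV2 ?posrE //; lra.
    rewrite mul1r divr1 yE; case: ifP => _; first by rewrite normr0; lra.
    apply: le_trans (ler_normB _ _) _; rewrite lerD ?Z'h //.
    by case: eqP; rewrite ?normr1 ?normr0.
  rewrite sumr_const card_ord -[leLHS]mulr_natl ler_wpM2r ?ler_nat //; lra.
have pW : project p (toR Z') = toR W.
  apply/matrixP => a b; rewrite projectE.
  have -> : \sum_l toR Z' a (rshift m.+1 l) * p l b = y a b.
    under eq_bigr => l _ do rewrite [p _ _]mxE mulr_sumr.
    rewrite exchange_big /= (bigD1 a) //= [X in _ + X]big1 ?addr0.
      have [aS|aS] := boolP (a \in S).
        have -> : y a b = 0 by rewrite yE aS.
        by apply: big1 => l _; rewrite mul0r !mulr0.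
      have [l fa] : exists l, f a = rshift m.+1 l.
        move: aS; rewrite inE; case: (split_ordP (f a)) => l ->.
          by [].
        by exists l.
      rewrite (bigD1 l) //= big1 ?addr0 => [|l' l'l].
        rewrite fa eqxx mul1r [toR Z' _ _]mxE -fa cramer_basis_diag eqxx mulr1n -/D mulrC divfK //.
        by rewrite -normr_eq0 gt_eqF //; lra.
      by rewrite fa (inj_eq (@rshift_inj _ _)) eq_sym (negbTE l'l) mul0r mulr0.
    move=> i' i'a; apply: big1 => l _; case: eqP => [fi|]; last by rewrite mul0r mulr0.
    by rewrite [toR Z' _ _]mxE -fi cramer_basis_diag eq_sym (negbTE i'a) mul0r.
  by rewrite /y [X in _ - X]mxE [M _ _]mxE [X in _ - (_ + X)]mxE opprB addrC subrK.
rewrite /graph_minor pW; apply: le_trans f'P; rewrite powRN powRrM powR_mulrn //.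
rewrite -[(2 * C)^-1 * _]invfM lef_pV2 ?posrE ?mulr_gt0 ?powR_gt0 ?exprn_gt0 ?(q_gt0 _ _) //; [|lra..].
rewrite -mulrA ler_pM2l //; apply: le_trans kq.
by rewrite ler_eXn2l ?ltr1n // (expo_mono g_ge2) // leq_add2l.
Qed.

End SkewSubspaces.

(** * Angles with the graph space *)

Section GraphAngles.
Context {R : realType} (m r : nat).
Local Notation n := (m.+1 + r)%N.
Context (y : 'rV[R]_m.+1) (eta : 'M[R]_(r, m.+1)).
Hypothesis eta01 : forall l j, 0 <= eta l j <= 1.

Definition graph_mx : 'M[R]_(1 + r, n) := block_mx y 0 eta 1%:M.

Definition graph_space : {vspace 'rV[R]_n} :=
  <<[tuple row i graph_mx | i < 1 + r]>>%VS.

Lemma graph_spaceP x : reflect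
  (exists a, exists v, x = row_mx (a *: y + v *m eta) v) (x \in graph_space).
Proof.
rewrite /graph_space mem_rows; apply: (iffP submxP) => [[c ->]|[a [v ->]]].
  exists (lsubmx c 0 0), (rsubmx c); rewrite -[c in LHS]hsubmxK /graph_mx mul_row_block.
  by rewrite mulmx0 add0r mulmx1 -mul_scalar_mx -mx11_scalar.
exists (row_mx a%:M v); rewrite /graph_mx mul_row_block mulmx0 add0r mulmx1.
by rewrite mul_scalar_mx.
Qed.

Lemma dim_graph_space : y != 0 -> \dim graph_space = r.+1.
Proof.
move=> y0; apply: dim_rows; apply/inj_row_free => c c0.
move: c0; rewrite -[c]hsubmxK /graph_mx mul_row_block mulmx0 add0r mulmx1.
rewrite -[RHS]row_mx0 => /eq_row_mx[cy c2]; move: cy; rewrite c2 mul0mx addr0.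
rewrite [lsubmx c]mx11_scalar mul_scalar_mx => /eqP; rewrite scaler_eq0 (negbTE y0) orbF.
by move=> /eqP ->; rewrite -scalemx1 scale0r row_mx0.
Qed.

Lemma l1_row_mx p q (u : 'rV[R]_p) (v : 'rV[R]_q) : l1 (row_mx u v) = l1 u + l1 v.
Proof.
by rewrite /l1 big_split_ord /=; congr (_ + _); apply: eq_bigr => i _;
  rewrite ?row_mxEl ?row_mxEr.
Qed.

Lemma l1_mul_le p q (v : 'rV[R]_p) (M : 'M[R]_(p, q)) (t : R) :
  (forall i j, `|M i j| <= t) -> l1 (v *m M) <= q%:R * (l1 v * t).
Proof.
move=> Mt; apply: l1_le => j; rewrite mxE; apply: le_trans (ler_norm_sum _ _ _) _.
by rewrite /l1 mulr_suml; apply: ler_sum => i _; rewrite normrM ler_wpM2l.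
Qed.

Lemma eta_le1 l j : `|eta l j| <= 1.
Proof. by have /andP[e0 e1] := eta01 l j; rewrite ger0_norm. Qed.

Lemma l1_mul_eta v : l1 (v *m eta) <= m.+1%:R * l1 v.
Proof. by have := l1_mul_le v eta_le1; rewrite mulr1. Qed.

(** If [x - s z] is small, so are its last coordinates, which are those of [x];
    hence the component of [x] on the graph of [eta] is negligible and [z] is
    close to the line of [y]. *)
Lemma graph_angle_sharp : exists2 C, 0 < C & forall x (z : 'rV[R]_m.+1) rho,
  x \in graph_space -> x != 0 -> z != 0 -> 0 <= rho <= 1 ->
  (forall a s, `|a| * rho <= l1 (a *: y - s *: z)) ->
  rho <= C * omega x (row_mx z 0).
Proof.
exists (m.+2%:R * (l1 y + 1) * n%:R ^+ 2).
  have L0 : 0 < l1 y + 1 by have := l1_ge0 y; lra.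
  by rewrite !mulr_gt0 ?exprn_gt0 ?ltr0n.
move=> x z rho xA x0 z0 /andP[rho0 rho1] H.
have [|s sP] := @omega_lower _ _ x (row_mx z (0 : 'rV[R]_r)).
  apply: contra_neq z0; rewrite -[0 in RHS]row_mx0 => h; exact: (eq_row_mx h).1.
have /graph_spaceP[a [v xE]] := xA.
set d := l1 _ in sP.
have dE : d = l1 (a *: y + v *m eta - s *: z) + l1 v.
  by rewrite /d xE scale_row_mx opp_row_mx add_row_mx scaler0 subr0 l1_row_mx.
have vd : l1 v <= d by rewrite dE lerDr l1_ge0.
have ad : `|a| * rho <= m.+2%:R * d.
  apply: le_trans (H a s) _.
  have -> : a *: y - s *: z = (a *: y + v *m eta - s *: z) + - (v *m eta).
    by rewrite addrAC addrK.
  apply: le_trans (l1D _ _) _; rewrite l1N -natr1 mulrDl mul1r addrC.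
  apply: lerD; last by rewrite dE lerDl l1_ge0.
  by apply: le_trans (l1_mul_eta v) _; rewrite ler_wpM2l.
have xd : l1 x <= `|a| * l1 y + m.+2%:R * d.
  rewrite xE l1_row_mx -natr1 mulrDl mul1r addrA; apply: lerD => //.
  apply: le_trans (l1D _ _) _; rewrite l1Z; apply: lerD => //.
  by apply: le_trans (l1_mul_eta v) _; rewrite ler_wpM2l.
have x1 := l1_gt0 x0.
rewrite -(ler_pM2r x1).
have d0 : 0 <= d by apply: l1_ge0.
have y0 := l1_ge0 y.
have xr : l1 x * rho <= m.+2%:R * (l1 y + 1) * d.
  have : l1 x * rho <= (`|a| * l1 y + m.+2%:R * d) * rho by rewrite ler_wpM2r.
  have : `|a| * rho * l1 y <= m.+2%:R * d * l1 y by rewrite ler_wpM2r.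
  have : m.+2%:R * d * rho <= m.+2%:R * d by rewrite ler_piMr // mulr_ge0.
  lra.
have := ler_wpM2l (_ : 0 <= m.+2%:R * (l1 y + 1)) sP.
rewrite mulrC in xr; move=> /(_ _)/(le_trans xr) h.
apply: le_trans (h _) _; first by rewrite mulr_ge0 // addr_ge0.
by rewrite le_eqVlt; apply/orP; left; apply/eqP; ring.
Qed.

(** The projection along the graph sends [x - s z] to a combination of [y] and of
    the projected rows of [Z]; by Cramer's rule the coefficients of this
    combination, hence [x] itself, are bounded by the projection of [x - s z]
    times cofactors, divided by the minor. *)
Lemma graph_angle_crude e : exists2 C, 0 < C &
  forall (Z : 'M[R]_(e, n)) h f x z, 1 <= h -> (forall i j, `|Z i j| <= h) ->
  x \in graph_space -> x != 0 -> (z <= Z)%MS -> z != 0 ->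
  `|graph_minor y Z f eta| <= C * omega x z * h ^+ e.+1.
Proof.
pose L := (l1 y + 1) * r.+1%:R.
have y0 := l1_ge0 y.
have L1 : 1 <= L by rewrite mulr_ege1 // ?ler1n //; lra.
pose C := n%:R * ((e.+1)`!%:R * L ^+ e * (L + 2 * e.+1%:R * m.+1%:R)).
exists (C * n%:R ^+ 2).
  have L0 : 0 < L by lra.
  have L2 : 0 < L + 2 * e.+1%:R * m.+1%:R by rewrite ltr_wpDr.
  by rewrite /C !mulr_gt0 ?exprn_gt0 ?ltr0n ?fact_gt0.
move=> Z h f x z h1 Zh xA x0 zZ z0.
have [s sP] := omega_lower x z0; set rr := x - s *: z in sP.
have /graph_spaceP[a [v xE]] := xA; have /submxP[c cE] := zZ.
pose W := project eta Z; pose M := colsub f (col_mx y W).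
have h0 : 0 <= h by lra.
pose T := L * h.
have Mt i j : `|M i j| <= T.
  rewrite mxE; case: (split_ordP i) => k ->.
    rewrite ord1 col_mxEu; apply: le_trans (coord_le_l1 y _) _.
    rewrite /T /L -mulrA; have : 1 <= r.+1%:R * h by rewrite mulr_ege1 // ler1n.
    nra.
  rewrite col_mxEd projectE; apply: le_trans (ler_normB _ _) _.
  have -> : T = (l1 y + 1) * (r.+1%:R * h) by rewrite /T /L mulrA.
  apply: (@le_trans _ _ (r.+1%:R * h)); last by rewrite ler_peMl ?mulr_ge0 //; lra.
  rewrite -natr1 mulrDl mul1r addrC; apply: lerD => //.
  apply: le_trans (ler_norm_sum _ _ _) _.
  apply: (@le_trans _ _ (\sum_(l < r) h)).
    by apply: ler_sum => l _; rewrite normrM -[leRHS]mulr1; apply: ler_pM; rewrite ?eta_le1.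
  by rewrite sumr_const card_ord mulr_natl.
have T0 : 0 <= T by rewrite /T mulr_ge0 //; lra.
set D := graph_minor y Z f eta.
have DE : D = \det M by [].
have Dle : `|D| <= (e.+1)`!%:R * T ^+ e.+1.
  by rewrite DE; apply: le_trans (det_le Mt) _; rewrite prodr_const card_ord.
have adjle i j : `|(\adj M) i j| <= e`!%:R * T ^+ e.
  rewrite mxE /cofactor normrM normrX normrN1 expr1n mul1r.
  apply: le_trans (det_le (rho := fun=> T) _) _; last by rewrite prodr_const card_ord.
  by move=> i' j'; rewrite [row' _ _ _ _]mxE [col' _ _ _ _]mxE; apply: Mt.
pose w := row_mx a%:M (- (s *: c)) : 'rV[R]_(1 + e).
have wM : w *m col_mx y W = project eta rr.
  rewrite mul_row_col mul_scalar_mx mulNmx -scalemxAl /W -project_mul -cE.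
  have -> : a *: y = project eta x by rewrite /project xE row_mxKl row_mxKr addrK.
  by rewrite /rr projectB_scale.
have wD : D *: w = colsub f (project eta rr) *m \adj M.
  by rewrite -wM colsub_mul -mulmxA mul_mx_adj mul_mx_scalar.
have prr : l1 (project eta rr) <= m.+1%:R * (2 * l1 rr).
  apply: l1_le => j; rewrite projectE; apply: le_trans (ler_normB _ _) _.
  rewrite mulr2n mulrDl mul1r; apply: lerD; first exact: coord_le_l1.
  apply: le_trans (ler_norm_sum _ _ _) _.
  rewrite /l1 [leRHS]big_split_ord /=; apply: ler_wpDl; first exact: sumr_ge0.
  by apply: ler_sum => l _; rewrite normrM ler_piMr // eta_le1.
have w1 : `|D| * l1 w <= e.+1%:R * ((e.+1)`!%:R * T ^+ e * (m.+1%:R * (2 * l1 rr))).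
  rewrite -l1Z wD; apply: l1_le => i; rewrite mxE.
  apply: le_trans (ler_norm_sum _ _ _) _.
  rewrite factS natrM -!mulrA.
  apply: (@le_trans _ _ (\sum_(j < 1 + e) e`!%:R * (T ^+ e * (m.+1%:R * (2 * l1 rr))))).
    apply: ler_sum => j _; rewrite normrM mulrA [leRHS]mulrC; apply: ler_pM => //.
    by rewrite mxE; apply: le_trans (coord_le_l1 _ _) prr.
  by rewrite sumr_const card_ord -[leLHS]mulr_natl.
have xw : l1 x <= n%:R * (l1 rr + l1 w * h).
  apply: l1_le => j.
  have -> : x 0 j = rr 0 j + (s *: c *m Z) 0 j.
    by rewrite -scalemxAl -cE /rr !mxE subrK.
  apply: le_trans (ler_normD _ _) _; apply: lerD; first exact: coord_le_l1.
  rewrite mxE; apply: le_trans (ler_norm_sum _ _ _) _.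
  rewrite l1_row_mx l1N mulrDl; apply: ler_wpDl; first by rewrite mulr_ge0 ?l1_ge0.
  by rewrite /l1 mulr_suml; apply: ler_sum => i _; rewrite normrM ler_wpM2l.
have rr0 := l1_ge0 rr; have x1 := l1_gt0 x0.
have xD : l1 x * `|D| <= C * l1 rr * h ^+ e.+1.
  have h2 : l1 x * `|D| <= n%:R * (l1 rr + l1 w * h) * `|D| by rewrite ler_wpM2r.
  have h3 : l1 rr * `|D| <= l1 rr * ((e.+1)`!%:R * T ^+ e.+1) by rewrite ler_wpM2l.
  have h4 : `|D| * l1 w * h <= e.+1%:R * ((e.+1)`!%:R * T ^+ e * (m.+1%:R * (2 * l1 rr))) * h.
    by rewrite ler_wpM2r.
  apply: le_trans h2 _; rewrite -mulrA /C -!mulrA ler_wpM2l //.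
  have -> : (l1 rr + l1 w * h) * `|D| = l1 rr * `|D| + `|D| * l1 w * h by ring.
  apply: le_trans (lerD h3 h4) _.
  by rewrite /T !(exprMn _ L h) !exprS le_eqVlt; apply/orP; left; apply/eqP; ring.
rewrite -(ler_pM2l x1); apply: le_trans xD _.
have -> : l1 x * (C * n%:R ^+ 2 * omega x z * h ^+ e.+1) =
  C * (n%:R ^+ 2 * omega x z * l1 x) * h ^+ e.+1 by ring.
rewrite ler_wpM2r ?exprn_ge0 // ler_wpM2l //.
by rewrite /C !mulr_ge0 ?exprn_ge0 ?addr_ge0 ?mulr_ge0 ?(l1_ge0 y) //; lra.
Qed.

End GraphAngles.

(** * Lower bounds for the angle with rational subspaces *)

Section LineDistance.
Context {R : realType} (m : nat) (g : nat -> R).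
Hypothesis (m_gt0 : (0 < m)%N) (g_ge2 : forall l, 2 <= g l).
Local Notation toR Z := (map_mx (intr : int -> R) Z).
Local Notation q k := (2 ^+ expo g k : R).
Local Notation Y := (target m g).

(** All the vectors of the frame but the first vanish at the coordinates [0] and
    [cyc (k + e)], whose ratio is therefore that of [approx k]. *)
Lemma line_distance_frame k e (z : 'rV[R]_m.+1) (a s : R) : (e < m)%N ->
  (z <= toR (frame m g k e))%MS ->
  `|a| * (4 * q (k + e).+1)^-1 <= l1 (a *: Y - s *: z).
Proof.
move=> em /submxP[c zE].
pose i := cyc m (k + e).
have zcoord j : (forall l, (l < e)%N -> j != cyc m (k + l)) ->
    z 0 j = c 0 0 * (approx m g k 0 j)%:~R.
  move=> jP; rewrite zE mxE big_ord_recl big1 ?addr0 => [|l _]; first by rewrite !mxE.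
  by rewrite !mxE /= ?mxE (negbTE (jP _ (ltn_ord l))) mulr0.
have z0 : z 0 0 = c 0 0 * q k.
  by rewrite zcoord ?approx_first ?intr_pow2 // => l _; rewrite eq_sym cyc_neq0.
have zi : z 0 i = slope g k i * z 0 0.
  rewrite z0 zcoord ?approx_slope => [|l le]; first by ring.
  by rewrite cyc_inj // ?(ltn_trans le) // eq_sym ltn_eqF.
set w := a *: Y - s *: z.
have key : w 0 i - slope g k i * w 0 0 = a * (Y 0 i - slope g k i).
  have Y0 := target_first m_gt0 g_ge2; rewrite /w !mxE in Y0 *.
  by move: zi; rewrite Y0 => ->; ring.
have gap : (q (k + e).+1)^-1 <= Y 0 i - slope g k i.
  have := target_gap m_gt0 g_ge2 (leq_addr e k); rewrite -/i div1r; lra.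
have qp : 0 < (q (k + e).+1)^-1 by rewrite invr_gt0 q_gt0.
have : `|a| * (q (k + e).+1)^-1 <= l1 w + 3 * l1 w.
  apply: (@le_trans _ _ `|w 0 i - slope g k i * w 0 0|).
    by rewrite key normrM ler_wpM2l // ger0_norm; lra.
  apply: le_trans (ler_normB _ _) _; apply: lerD; first exact: coord_le_l1.
  rewrite normrM; apply: ler_pM => //; last exact: coord_le_l1.
  by rewrite ger0_norm ?slope_le3 // slope0_ge0.
by rewrite invfM; lra.
Qed.

(** The wedge product with [V] only sees [a Y - s z] modulo the rows of [V]. *)
Lemma line_distance_minor e (V : 'M[R]_(e, m.+1)) (z : 'rV[R]_m.+1) a s f :
  (z <= V)%MS ->
  `|a| * `|\det (colsub f (col_mx Y V))| <= e.+1%:R * l1 (a *: Y - s *: z) * minors V.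
Proof.
move=> /submxP[c zE].
have z0 : \det (colsub f (col_mx z V)) = 0.
  apply/eqP/det0P; exists (row_mx 1 (- c)).
    apply/eqP => /rowP/(_ (lshift e 0))/eqP.
    by rewrite row_mxEl !mxE eqxx oner_eq0.
  rewrite -colsub_mul mul_row_col mul1mx mulNmx -zE subrr.
  by apply/matrixP => i j; rewrite !mxE.
rewrite -normrM.
have -> : a * \det (colsub f (col_mx Y V)) = \det (colsub f (col_mx (a *: Y - s *: z) V)).
  have d0 : \det (colsub f (col_mx (0 : 'rV[R]_m.+1) V)) = 0.
    by rewrite minor_col_mx big1 // => j _; rewrite mxE mul0r.
  by rewrite minor_col_mx_lin -[- (s *: z)]addr0 -scaleNr minor_col_mx_lin z0 d0 mulr0 !addr0.
by apply: minor_col_mx_le => j; apply: coord_le_l1.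
Qed.

End LineDistance.

Section CoreBounds.
Context {R : realType} (m r : nat) (g : nat -> R) (G : R).
Hypothesis (m_gt0 : (0 < m)%N) (g_ge2 : forall l, 2 <= g l) (g_leG : forall l, g l <= G).
Local Notation n := (m.+1 + r)%N.
Local Notation toR Z := (map_mx (intr : int -> R) Z).
Local Notation q k := (2 ^+ expo g k : R).
Local Notation Y := (target m g).

Lemma target_neq0 : Y != 0.
Proof.
apply/eqP => /rowP/(_ 0)/eqP; rewrite target_first // [X in _ == X]mxE.
by rewrite oner_eq0.
Qed.

Definition saturated e (Z : 'M[int]_(e, n)) :=
  forall v : 'rV[int]_n, (toR v <= toR Z)%MS -> exists u : 'rV[int]_e, v = u *m Z.

(** The frame is then an integral combination of the rows of [Z] and, being
    primitive, is unimodularly equivalent to them; one of its minors is [q k]. *)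
Lemma frame_height k e (Z : 'M[int]_(e.+1, n)) : (e < m)%N ->
  saturated Z -> rsubmx Z = 0 -> row_free (toR Z) ->
  (toR (frame m g k e) <= toR (lsubmx Z))%MS ->
  (toR (lsubmx Z) <= toR (frame m g k e))%MS /\ q k <= wedge_norm (toR Z).
Proof.
move=> em sZ Z2 fZ fr; have ffr := frame_free m_gt0 g_ge2 k (ltnW em).
have ZE : Z = row_mx (lsubmx Z) 0 by rewrite -Z2 hsubmxK.
split.
  rewrite -(geq_leqif (mxrank_leqif_sup fr)) (eqP ffr); exact: rank_leq_row.
have /choice[u uP] : forall i, exists u : 'rV[int]_e.+1, row i (frame m g k e) = u *m lsubmx Z.
  move=> i; have /submxP[c cE] : (toR (row i (frame m g k e)) <= toR (lsubmx Z))%MS.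
    by rewrite map_row; apply: submx_trans fr; apply: row_sub.
  have [|u uE] := sZ (row_mx (row i (frame m g k e)) 0).
    apply/submxP; exists c; rewrite ZE !map_row_mx cE mul_mx_row !map_mx0 mulmx0.
    by [].
  exists u; move: uE; rewrite {1}ZE mul_mx_row => /eq_row_mx[-> _].
  by [].
have frE : frame m g k e = (\matrix_i u i) *m lsubmx Z.
  by apply/row_matrixP => i; rewrite uP row_mul rowK.
have U1 := frame_primitive m_gt0 g_ge2 em frE.
have ncyc i : (i < e)%N -> 0 != cyc m (k + i) by rewrite eq_sym cyc_neq0.
have := frame_minor g m_gt0 (ltnW em) ncyc.
set f := frame_cols _ _ => /(congr1 (fun z : int => `|z%:~R : R|)).
rewrite approx_first // intr_pow2 (gtr0_norm (q_gt0 _ _)) => <-.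
rewrite frE colsub_mul det_mulmx intrM normrM -intr_norm -abszE U1 mul1r -minor_toR.
have -> : colsub f (toR (lsubmx Z)) = colsub (fun i => lshift r (f i)) (toR Z).
  by apply/matrixP => i j; rewrite !mxE.
exact: minor_le_wedge.
Qed.

Lemma minors_lsubmx_le e (Z : 'M[int]_(e, n)) :
  minors (toR (lsubmx Z)) <= (m.+1 ^ e)%:R * wedge_norm (toR Z).
Proof.
apply: minors_le_const => f.
have -> : colsub f (toR (lsubmx Z)) = colsub (fun i => lshift r (f i)) (toR Z).
  by apply/matrixP => i j; rewrite !mxE.
exact: minor_le_wedge.
Qed.

(** Either the subspace contains the [e + 1] approximants that follow the scale of
    its height, and it is explicit, or it misses one of them, and its wedge product
    with the target is bounded below by integrality. *)
Lemma sharp_bound (eta : 'M[R]_(r, m.+1)) e (mu : R) : (e < m)%N ->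
  (forall l j, 0 <= eta l j <= 1) ->
  (forall k, 0 <= g k ^+ 2 - 3 * g k + 1) ->
  (forall k, window g k e.+1 <= mu) ->
  exists2 c : R, 0 < c & forall Z : 'M[int]_(e.+1, n),
    row_free (toR Z) -> saturated Z -> rsubmx Z = 0 ->
    forall x z, x \in graph_space Y eta -> x != 0 -> (z <= toR Z)%MS -> z != 0 ->
      c * wedge_norm (toR Z) `^ (- mu) <= omega x z.
Proof.
move=> em eta01 gold gmu.
have w1 k l : 1 <= window g k l by apply: window_ge1 => i; have := g_ge2 i; lra.
have mu1 : 0 <= mu - 1 by have := gmu 0%N; have := w1 0%N e.+1; lra.
pose Cm : R := (m.+1 ^ e.+1)%:R.
have Cm1 : 1 <= Cm by rewrite ler1n expn_gt0.
pose C0 : R := 4 * e.+2%:R * Cm.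
have C0_1 : 1 <= C0 by apply: mulr_ege1 => //; apply: mulr_ege1; rewrite ?ler1n //; lra.
have gap k : window g k.+1 e * (expo g k.+1)%:R <=
    (mu - 1) * ((expo g k.+1)%:R - (expo g k)%:R).
  exact: (window_gap_sharp g_ge2 (gold k) (gmu k)).
have [C1 C1p CP] := scale_of_height g_ge2 g_leG mu1 C0_1 gap.
have [C2 C2p C2P] := expo_window_powR g_ge2 g_leG e.+1.
have [C3 C3p C3P] := graph_angle_sharp Y eta01.
pose K := 4 * C2 + 2 * e.+2%:R * Cm * C1.
have KC1 : 0 <= 2 * e.+2%:R * Cm * C1 by rewrite !mulr_ge0 //; lra.
have K0 : 0 < K by rewrite ltr_pwDl // mulr_gt0 //; lra.
exists (C3 * K)^-1 => [|Z fZ sZ Z2 x z xA x0 zZ z0]; first by rewrite invr_gt0 mulr_gt0.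
set h := wedge_norm (toR Z); have h1 : 1 <= h := wedge_ge1 fZ.
have h0 : 0 <= h by lra.
have hmu : 0 < h `^ mu by rewrite powR_gt0; lra.
have ZE : toR Z = row_mx (toR (lsubmx Z)) 0.
  by rewrite -[Z in LHS]hsubmxK Z2 map_row_mx map_mx0.
have [z1 z1Z zE] : exists2 z1 : 'rV[R]_m.+1, (z1 <= toR (lsubmx Z))%MS & z = row_mx z1 0.
  case/submxP: zZ => c ->; exists (c *m toR (lsubmx Z)); first exact: submxMl.
  by rewrite [in LHS]ZE mul_mx_row mulmx0.
have z10 : z1 != 0 by apply: contra_neq z0 => z10; rewrite zE z10 row_mx0.
suff [rho [rho01 rhoK rhoP]] : exists rho, [/\ 0 <= rho <= 1, h `^ (- mu) / K <= rho &
    forall a s, `|a| * rho <= l1 (a *: Y - s *: z1)].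
  rewrite invfM mulrAC [C3^-1 * _]mulrC -mulrA mulrC -mulrA ler_pdivrMl //.
  rewrite mulrC zE; apply: le_trans rhoK _; exact: C3P.
have fZ1 : row_free (toR (lsubmx Z)).
  apply/inj_row_free => c c0; apply/eqP; rewrite -(mulmx_free_eq0 _ fZ) ZE mul_mx_row c0.
  by rewrite mulmx0 row_mx0.
have [k [kbig kq]] := CP h h1.
have [frin|frout] := boolP (toR (frame m g k e) <= toR (lsubmx Z))%MS.
  have [Zfr qh] := frame_height em sZ Z2 fZ frin.
  have q1 := q_ge1 g (k + e).+1.
  exists (4 * q (k + e).+1)^-1; split.
  - by rewrite invr_ge0 invf_le1; lra.
  - rewrite powRN -invfM lef_pV2 ?posrE ?mulr_gt0 //.
    have := C2P k; rewrite addnS => qk.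
    have qmu : q k `^ window g k e.+1 <= h `^ mu.
      apply: (@le_trans _ _ (q k `^ mu)); first by rewrite ler_powR ?q_ge1.
      by apply: ge0_ler_powR => //; rewrite ?nnegrE ?(ltW (q_gt0 _ _)) //; lra.
    have : C2 * q k `^ window g k e.+1 <= C2 * h `^ mu by rewrite ler_pM2l.
    have : 0 <= h `^ mu * (2 * e.+2%:R * Cm * C1) by rewrite mulr_ge0 // ltW.
    rewrite /K; lra.
  - move=> a s; apply: line_distance_frame => //; exact: submx_trans Zfr.
have [i ie Xi] : exists2 i, (i <= e)%N & ~~ (toR (approx m g (k + i)) <= toR (lsubmx Z))%MS.
  apply: contrapT => H; case/negP: frout; apply: frame_sub => i ie.
  by apply: contrapT => /negP Xi; apply: H; exists i.
have minZ := minors_lsubmx_le Z.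
have [||f fP] := @target_wedge_ge R m g m_gt0 g_ge2 (k + i) e.+1 (lsubmx Z).
- by rewrite map_col_mx; apply: row_free_col_mx.
- apply: le_trans (kbig (k + i)%N (leq_addr _ _)).
  rewrite ler_wpM2r ?(ltW (q_gt0 _ _)) // /C0 -[leRHS]mulrA ler_wpM2l // mulr_ge0 //; lra.
have qie : q (k + i) <= q (k + e).
  by rewrite ler_eXn2l ?ltr1n // (expo_mono g_ge2) // leq_add2l.
have q1 := q_ge1 g (k + e).
pose N := 2 * e.+2%:R * Cm * h * q (k + e).
have N1 : 1 <= N.
  rewrite /N; do 3!apply: mulr_ege1 => //; apply: mulr_ege1 => //; first lra.
  by rewrite ler1n.
exists N^-1; split.
- by rewrite invr_ge0 invf_le1; lra.
- have N0 : 0 < N by lra.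
  rewrite powRN -invfM lef_pV2 ?posrE ?(mulr_gt0 hmu K0) //.
  have hh : h * h `^ (mu - 1) = h `^ mu.
    rewrite -{1}(powRr1 h0) -powRD; last by apply/implyP => _; rewrite gt_eqF //; lra.
    by congr (_ `^ _); ring.
  have : h * q (k + e) <= h * (C1 * h `^ (mu - 1)) by rewrite ler_wpM2l.
  rewrite mulrCA hh => hq.
  have : 2 * e.+2%:R * Cm * (h * q (k + e)) <= 2 * e.+2%:R * Cm * (C1 * h `^ mu).
    by rewrite ler_wpM2l // !mulr_ge0 //; lra.
  have : 0 <= C2 * h `^ mu by rewrite mulr_ge0 // ltW.
  rewrite /N /K; lra.
- move=> a s; have := line_distance_minor g a s f z1Z.
  set d := l1 _ => dP.
  have d0 : 0 <= d by apply: l1_ge0.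
  have a1 : `|a| * (2 * q (k + i))^-1 <= e.+2%:R * d * (Cm * h).
    apply: le_trans (ler_wpM2l (normr_ge0 a) fP) _; apply: le_trans dP _.
    by rewrite ler_wpM2l // mulr_ge0.
  rewrite ler_pdivrMr; last by lra.
  rewrite ler_pdivrMr in a1; last by rewrite mulr_gt0 ?q_gt0.
  apply: le_trans a1 _; rewrite /N.
  have : e.+2%:R * d * (Cm * h) * 2 * q (k + i) <= e.+2%:R * d * (Cm * h) * 2 * q (k + e).
    by rewrite ler_wpM2l // !mulr_ge0 //; lra.
  lra.
Qed.

Lemma dyadic_above (h : R) : 1 <= h -> exists2 j : nat, h <= 2 ^+ j & 2 ^+ j <= 2 * h.
Proof.
move=> h1; have ex : exists j, h <= 2 ^+ j.
  exists (Num.truncn h).+1; apply: le_trans (ltW (truncnS_gt _)) _.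
  by rewrite -natrX ler_nat; apply: ltnW; apply: ltn_expl.
exists (ex_minn ex); case: ex_minnP => // -[|j] _ jmin; first by rewrite expr0; lra.
rewrite exprS ler_pM2l; last by lra.
by rewrite leNgt; apply/negP => /ltW /jmin; rewrite ltnn.
Qed.

(** All the losses are powers of the height: [generic_loss] for the choice of
    [eta], [e + 2] for [graph_angle_crude], and the rest for [skew_witness]; the
    last hypothesis makes their sum at most [mu e]. *)
Lemma skew_bound (mu : nat -> R) (gmin : R) :
  2 <= gmin -> (forall k, gmin <= g k) ->
  (forall e k, (e < m)%N -> window g k e.+1 <= mu e) ->
  (forall e, (e < m)%N ->
    (generic_loss m r)%:R + e.+2%:R + e.+1%:R * (mu e / (gmin - 1)) <= mu e) ->
  exists2 eta : 'M[R]_(r, m.+1), forall l j, 0 <= eta l j <= 1 &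
  forall e, (e < m)%N -> exists2 c : R, 0 < c & forall Z : 'M[int]_(e.+1, n),
    row_free (toR Z) -> rsubmx Z != 0 ->
    forall x z, x \in graph_space Y eta -> x != 0 -> (z <= toR Z)%MS -> z != 0 ->
      c * wedge_norm (toR Z) `^ (- mu e) <= omega x z.
Proof.
move=> gm2 gmin_le gmu loss.
pose kap e := mu e / (gmin - 1).
have kap0 e : (e < m)%N -> 0 <= kap e.
  move=> em; apply: divr_ge0; last by lra.
  have := gmu e 0%N em; have : 1 <= window g 0 e.+1; last by lra.
  by apply: window_ge1 => i; have := g_ge2 i; lra.
have /choice[cw cwP] : forall e, exists c : R, 0 < c /\ ((e < m)%N ->
    forall Z : 'M[int]_(e.+1, n),
    row_free (toR Z) -> rsubmx Z != 0 ->
    exists Z' : 'M[int]_(e.+1, n), exists f, exists p : 'M[R]_(r, m.+1),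
      [/\ (toR Z' :=: toR Z)%MS,
          forall i j, `|(Z' i j)%:~R| <= wedge_norm (toR Z),
          forall l j, `|p l j| <= m%:R * (wedge_norm (toR Z) + 1) &
          c * wedge_norm (toR Z) `^ (- (e.+1%:R * kap e))
            <= `|graph_minor Y (toR Z') f p|]).
  move=> e; have [em|me] := ltnP e m; last by exists 1.
  have [|c c0 cP] := skew_witness r m_gt0 g_ge2 g_leG em (kap0 e em).
    move=> k; exact: (window_gap_crude g_ge2 gm2 (gmin_le k) (gmu e k em)).
  by exists c.
pose tau e j : R := if e is e'.+1 then cw e' * (2 ^+ j) `^ (- (e'.+1%:R * kap e')) else 0.
have tau0 e j : 0 <= tau e j.
  by case: e => [|e] //=; rewrite mulr_ge0 ?powR_ge0 // ltW //; case: (cwP e).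
have [eta eta01 [cg cg0 cgP]] := generic_graph r Y m_gt0 tau0.
exists eta => // e em; have [cw0 /(_ em) cwE] := cwP e.
have [C C0 CP] := graph_angle_crude Y eta01 e.+1.
set P : R := (generic_loss m r)%:R + e.+1%:R * kap e.
have P0 : 0 <= P by rewrite addr_ge0 // mulr_ge0 // kap0.
exists (cg * cw e * 2 `^ (- P) / C).
  by rewrite divr_gt0 // !mulr_gt0 // powR_gt0.
move=> Z fZ Z2 x z xA x0 zZ z0.
set h := wedge_norm (toR Z); have h1 : 1 <= h := wedge_ge1 fZ.
have h0 : 0 < h by lra.
have [Z' [f [p [Z'Z Z'h ph pF]]]] := cwE Z fZ Z2.
have [j hj jh] := dyadic_above h1.
have Feta := cgP e.+1 j Z' f p em.
have pw_anti t : 0 <= t -> (2 ^+ j) `^ (- t) <= h `^ (- t).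
  move=> t0; rewrite !powRN lef_pV2 ?posrE ?powR_gt0 ?exprn_gt0 //.
  by apply: ge0_ler_powR => //; rewrite nnegrE ?exprn_ge0 // ltW.
have {}Feta : cg / (2 ^+ j) ^+ generic_loss m r * tau e.+1 j <= `|graph_minor Y (toR Z') f eta|.
  apply: Feta.
  - move=> a b; rewrite -(@ler_nat R) natrX natr_absz intr_norm.
    exact: le_trans (Z'h a b) hj.
  - move=> l b; apply: le_trans (ph l b) _.
    by rewrite ler_wpM2l // lerD2r.
  - apply: le_trans pF; rewrite /= ler_pM2l //; apply: pw_anti.
    by rewrite mulr_ge0 // kap0.
have := CP (toR Z') h f x z h1 _ xA x0 _ z0.
move=> /(_ _ _)/(le_trans Feta) H.
have {}H : cg / (2 ^+ j) ^+ generic_loss m r * tau e.+1 j <= C * omega x z * h ^+ e.+2.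
  by apply: H; [move=> a b; rewrite mxE; apply: Z'h|rewrite Z'Z].
have lhs : cg * cw e * (2 `^ (- P) * h `^ (- P)) <= cg / (2 ^+ j) ^+ generic_loss m r * tau e.+1 j.
  have -> : cg / (2 ^+ j) ^+ generic_loss m r * tau e.+1 j = cg * cw e * (2 ^+ j) `^ (- P).
    rewrite /tau -[_ ^+ generic_loss m r]powR_mulrn ?exprn_ge0 // -powRN mulrACA.
    rewrite -powRD ?opprD //.
    by apply/implyP => _; rewrite expf_neq0.
  rewrite ler_pM2l ?mulr_gt0 // -powRM //; last by lra.
  rewrite !powRN lef_pV2 ?posrE ?powR_gt0 ?exprn_gt0 ?mulr_gt0 //.
  by apply: ge0_ler_powR => //; rewrite nnegrE ?exprn_ge0 ?mulr_ge0 //; lra.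
have {}H := le_trans lhs H.
have hP : h `^ (- mu e) * h ^+ e.+2 <= h `^ (- P).
  rewrite -powR_mulrn ?(ltW h0) // -powRD; last by apply/implyP => _; rewrite gt_eqF.
  by rewrite ler_powR //; have := loss e em; rewrite -/(kap e) /P; lra.
have hk : 0 < h ^+ e.+2 by rewrite exprn_gt0.
rewrite -(ler_pM2r hk) -(ler_pM2l C0) [C * (omega x z * _)]mulrA.
apply: le_trans H; rewrite [leRHS]mulrA.
apply: (@le_trans _ _ (cg * cw e * 2 `^ (- P) * (h `^ (- mu e) * h ^+ e.+2))).
  by rewrite le_eqVlt; apply/orP; left; apply/eqP; field; rewrite gt_eqF.
by rewrite ler_wpM2l // !mulr_ge0 ?powR_ge0 // ltW.
Qed.

End CoreBounds.

(** * Exponents of the graph space *)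

Section Exponents.
Context {R : realType} (m r : nat) (g : nat -> R) (G : R).
Hypothesis (m_gt0 : (0 < m)%N) (g_ge2 : forall l, 2 <= g l) (g_leG : forall l, g l <= G).
Local Notation n := (m.+1 + r)%N.
Local Notation toR Z := (map_mx (intr : int -> R) Z).
Local Notation q k := (2 ^+ expo g k : R).
Local Notation Y := (target m g).

(** For [r = 0] every subspace lies in the first factor; otherwise the ratios have
    to absorb the losses of [skew_bound]. *)
Lemma core_bound (mu : nat -> R) :
  (forall k, 0 <= g k ^+ 2 - 3 * g k + 1) ->
  (forall e k, (e < m)%N -> window g k e.+1 <= mu e) ->
  r = 0%N \/ (exists gmin, [/\ 2 <= gmin, forall k, gmin <= g k & forall e, (e < m)%N ->
    (generic_loss m r)%:R + e.+2%:R + e.+1%:R * (mu e / (gmin - 1)) <= mu e]) ->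
  exists eta : 'M[R]_(r, m.+1), forall e, (e < m)%N -> exists2 c : R, 0 < c &
    forall B, rational_subspaces e.+1 B ->
    forall x z, x \in graph_space Y eta -> x != 0 -> z \in B -> z != 0 ->
      c * height B `^ (- mu e) <= omega x z.
Proof.
move=> gold gmu skew.
have [eta eta01 sk] : exists2 eta : 'M[R]_(r, m.+1), forall l j, 0 <= eta l j <= 1 &
  forall e, (e < m)%N -> exists2 c : R, 0 < c & forall Z : 'M[int]_(e.+1, n),
    row_free (toR Z) -> rsubmx Z != 0 ->
    forall x z, x \in graph_space Y eta -> x != 0 -> (z <= toR Z)%MS -> z != 0 ->
      c * wedge_norm (toR Z) `^ (- mu e) <= omega x z.
  case: skew => [r0|[gmin [gm2 gm loss]]]; last first.
    exact: (skew_bound m_gt0 g_ge2 g_leG gm2 gm gmu loss).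
  exists 0 => [l j|e _]; first by rewrite mxE lexx ler01.
  exists 1 => // Z _ /eqP[]; apply/matrixP => i j.
  by have := ltn_ord j; rewrite [X in (_ < X)%N]r0.
exists eta => e em.
have [c1 c1p c1P] := sharp_bound m_gt0 g_ge2 g_leG em eta01 gold (fun k => gmu e k em).
have [c2 c2p c2P] := sk e em.
exists (Num.min c1 c2) => [|B rB x z xA x0 zB z0]; first by rewrite lt_min c1p.
have [Z [fZ BZ Zint ->]] := rational_Zbasis rB.
have sZ : saturated (R := R) Z by move=> v vZ; apply: Zint; rewrite BZ.
rewrite BZ in zB; have hp := powR_ge0 (wedge_norm (toR Z)) (- mu e).
have [Z2|Z2] := eqVneq (rsubmx Z) 0.
  apply: le_trans (c1P Z fZ sZ Z2 x z xA x0 zB z0).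
  by rewrite ler_wpM2r // ge_min lexx.
apply: le_trans (c2P Z fZ Z2 x z xA x0 zB z0).
by rewrite ler_wpM2r // ge_min lexx orbT.
Qed.

Context (eta : 'M[R]_(r, m.+1)) (e : nat).
Hypothesis (em : (e < m)%N).
Local Notation A := (graph_space Y eta).

Lemma dimA : \dim A = r.+1.
Proof. by apply: dim_graph_space; apply: target_neq0. Qed.

Lemma A_neq0 : A != 0%VS.
Proof. by rewrite -dimv_eq0 dimA. Qed.

Lemma rational_neq0 (B : {vspace 'rV[R]_n}) : rational_subspaces e.+1 B -> B != 0%VS.
Proof. by move=> [dB _]; rewrite -dimv_eq0 dB. Qed.

Lemma dims_le (B : {vspace 'rV[R]_n}) : rational_subspaces e.+1 B -> (\dim A + \dim B <= n)%N.
Proof. by move=> [-> _]; rewrite dimA; lia. Qed.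

Lemma height_ge1 (B : {vspace 'rV[R]_n}) : rational_subspaces e.+1 B -> 1 <= height B.
Proof. by move=> /rational_Zbasis[Z [fZ _ _ ->]]; apply: wedge_ge1. Qed.

Definition frame_ext k : 'M[int]_(e.+1, n) := row_mx (frame m g k e) 0.

Definition frame_space k : {vspace 'rV[R]_n} :=
  <<[tuple row i (toR (frame_ext k)) | i < e.+1]>>%VS.

Lemma frame_row_mx_free k : row_free (toR (frame_ext k)).
Proof.
apply/inj_row_free => u u0; apply/eqP.
rewrite -(mulmx_free_eq0 _ (frame_free m_gt0 g_ge2 k (ltnW em))).
by move: u0; rewrite /frame_ext map_row_mx mul_mx_row -[RHS]row_mx0 => /eq_row_mx[-> _].
Qed.

Lemma rational_frame_space k : rational_subspaces e.+1 (frame_space k).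
Proof. exact: rational_rows (frame_row_mx_free k). Qed.

(** Only the first row of the frame is large, so the minors are linear in it. *)
Lemma frame_minors_le : exists2 C : R, 0 < C & forall k,
  minors (toR (frame_ext k)) <= C * q k.
Proof.
exists ((n ^ e.+1)%:R * (e.+1)`!%:R * 3) => [|k].
  by rewrite !mulr_gt0 ?ltr0n ?expn_gt0 ?fact_gt0 //; lra.
rewrite -!mulrA; apply: minors_le_const => f.
apply: le_trans (det_le (rho := fun i => if i == 0 then 3 * q k else 1) _) _.
  move=> i j; rewrite mxE [toR _ _ _]mxE /frame_ext mxE; case: splitP => l _.
    rewrite mxE -[i == 0 :> nat]/(i == 0); case: eqP => _.
      rewrite approx_slope normrM (gtr0_norm (q_gt0 _ _)) mulrC ler_pM2r ?q_gt0 //.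
      by rewrite ger0_norm ?slope0_ge0 // slope_le3.
    by rewrite mxE; case: (_ && _); rewrite ?normr1 ?normr0.
  rewrite mxE normr0; case: eqP => // _; have := q_ge1 g k; lra.
by rewrite big_ord_recl big1 ?mulr1.
Qed.

Lemma frame_space_height_ge k : q k <= height (frame_space k).
Proof.
have [Z [fZ BZ Zint ->]] := rational_Zbasis (rational_frame_space k).
have sZ : saturated (R := R) Z by move=> v vZ; apply: Zint; rewrite BZ.
have eqV (x : 'rV[R]_n) : (x <= toR Z)%MS =
    (x <= toR (frame_ext k))%MS.
  by rewrite -BZ /frame_space mem_rows.
have Z2 : rsubmx Z = 0.
  have /submxP[D DE] : (toR Z <= toR (frame_ext k))%MS.
    by apply/row_subP => i; rewrite -eqV row_sub.
  have : rsubmx (toR Z) = 0 by rewrite DE /frame_ext map_row_mx mul_mx_row row_mxKr map_mx0 mulmx0.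
  move=> /matrixP h; apply/matrixP => i j.
  by have := h i j; rewrite !mxE => /eqP; rewrite intr_eq0 => /eqP.
have fr : (toR (frame m g k e) <= toR (lsubmx Z))%MS.
  have /submxP[D DE] : (toR (frame_ext k) <= toR Z)%MS.
    by apply/row_subP => i; rewrite eqV row_sub.
  apply/submxP; exists D; move: DE; rewrite /frame_ext -{1}[Z]hsubmxK !map_row_mx mul_mx_row.
  by move=> /eq_row_mx[].
by have [] := frame_height m_gt0 g_ge2 em sZ Z2 fZ fr.
Qed.

Lemma frame_space_height_le : exists2 C : R, 0 < C & forall k,
  height (frame_space k) <= C * q k.
Proof.
have [C C0 CP] := frame_minors_le; exists C => // k.
have [Z [fZ BZ Zint ->]] := rational_Zbasis (rational_frame_space k).
apply: le_trans (CP k); apply: le_trans (wedge_le_minors _).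
set V := frame_ext k.
have /choice[u uP] : forall i, exists u : 'rV[int]_e.+1, row i V = u *m Z.
  by move=> i; apply: Zint; rewrite /frame_space mem_rows -/V map_row row_sub.
have VE : toR V = toR (\matrix_i u i) *m toR Z.
  by rewrite -map_mxM; congr (map_mx _ _); apply/row_matrixP => i; rewrite uP row_mul rowK.
have U0 : \det (\matrix_i u i) != 0.
  have /row_free_minor[f] := frame_row_mx_free k; rewrite -/V minor_toR intr_eq0.
  have -> : V = (\matrix_i u i) *m Z by apply/row_matrixP => i; rewrite uP row_mul rowK.
  by rewrite colsub_mul det_mulmx mulf_eq0 negb_or => /andP[].
rewrite VE wedge_norm_mul ler_peMl ?wedge_norm_ge0 // det_map_mx.
exact: norm_int_ge1.
Qed.

(** The angle is at most that of the target with the last approximant of the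
    frame. *)
Lemma frame_space_psi k :
  psi 1 A (frame_space k) <= 12 * (n ^ 2)%:R / q (k + e).+1.
Proof.
have rB := rational_frame_space k.
pose x : 'rV[R]_n := row_mx Y 0; pose z : 'rV[R]_n := row_mx (toR (approx m g (k + e))) 0.
have xA : x \in A.
  by apply/graph_spaceP; exists 1, 0; rewrite /x scale1r mul0mx addr0.
set Q := q (k + e); have Q0 : 0 < Q := q_gt0 g (k + e).
have x_first : x 0 (lshift r 0) = 1 by rewrite row_mxEl target_first.
have z_first : z 0 (lshift r 0) = Q by rewrite row_mxEl mxE approx_first // intr_pow2.
have x0 : x != 0.
  by apply: contra_eq_neq x_first => ->; rewrite mxE eq_sym oner_eq0.
have z0 : z != 0.
  by apply: contra_eq_neq z_first => ->; rewrite mxE eq_sym gt_eqF.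
have zB : z \in frame_space k.
  rewrite /frame_space mem_rows /frame_ext map_row_mx /z.
  have : (toR (approx m g (k + e)) <= toR (frame m g k e))%MS.
    exact: approx_sub_frame.
  by move=> /submxP[D DE]; apply/submxP; exists D; rewrite DE mul_mx_row map_mx0 mulmx0.
have [_ psi_le] := psi1P A_neq0 (rational_neq0 rB) (dims_le rB).
apply: le_trans (psi_le x z xA x0 zB z0) _.
have Q1 : 0 < q (k + e).+1 by apply: q_gt0.
have delta i : `|Q * x 0 i - z 0 i| <= 2 * Q / q (k + e).+1.
  case: (split_ordP i) => j ->.
    by rewrite !row_mxEl [toR _ _ _]mxE; exact: target_approx.
  by rewrite !row_mxEr !mxE mulr0 subrr normr0 divr_ge0 ?mulr_ge0 // ltW.
have zle i : `|z 0 i| <= 3 * Q.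
  case: (split_ordP i) => j ->; last by rewrite row_mxEr mxE normr0 mulr_ge0 // ltW.
  rewrite row_mxEl mxE approx_slope normrM gtr0_norm // mulrC ler_pM2r //.
  by rewrite ger0_norm ?slope0_ge0 // slope_le3.
have wle : wedge_norm (col_mx x z) <= (n ^ 2)%:R * (12 * Q / q (k + e).+1).
  apply: le_trans (wedge_le_minors _) _; apply: minors_le_const => f; rewrite det_pair.
  rewrite -(ler_pM2l Q0) -[X in X * `|_|]gtr0_norm // -normrM.
  set i := f 0; set j := f 1.
  have -> : Q * (x 0 i * z 0 j - x 0 j * z 0 i) =
    (Q * x 0 i - z 0 i) * z 0 j - (Q * x 0 j - z 0 j) * z 0 i by ring.
  apply: le_trans (ler_normB _ _) _; rewrite !normrM.
  apply: (@le_trans _ _ (2 * Q / q (k + e).+1 * (3 * Q) + 2 * Q / q (k + e).+1 * (3 * Q))).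
    by apply: lerD; apply: ler_pM.
  by rewrite le_eqVlt; apply/orP; left; apply/eqP; field; rewrite gt_eqF.
rewrite /omega ler_pdivrMr ?mulr_gt0 ?enorm_gt0 //.
apply: le_trans wle _.
have ex : 1 <= enorm x by have := coord_le_enorm x (lshift r 0); rewrite x_first normr1.
have ez : Q <= enorm z.
  by have := coord_le_enorm z (lshift r 0); rewrite z_first gtr0_norm.
have Qxz : Q <= enorm x * enorm z.
  by rewrite -[leLHS]mul1r; apply: ler_pM => //; apply: ltW.
have -> : (n ^ 2)%:R * (12 * Q / q (k + e).+1) = 12 * (n ^ 2)%:R / q (k + e).+1 * Q by ring.
by rewrite ler_wpM2l // divr_ge0 ?mulr_ge0 // ltW.
Qed.

Lemma finite_height_bounded (S : set {vspace 'rV[R]_n}) : finite_set S ->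
  exists T : R, forall B, S B -> height B <= T.
Proof.
move=> /finite_seqP[s ->]; exists (\sum_(B <- s) `|height B|) => B /= Bs.
rewrite (big_rem B) //=; apply: le_trans (ler_norm _) _.
by rewrite lerDl sumr_ge0.
Qed.

(** The frames starting at the [k] with a large window give infinitely many
    subspaces, since their heights tend to infinity. *)
Lemma exponent_ge (mu : R) : (forall N, exists2 k, (N <= k)%N & mu <= window g k e.+1) ->
  (mu%:E <= exponent A e.+1 1)%E.
Proof.
move=> often.
have [C C0 CP] := frame_space_height_le.
apply/lee_addgt0Pr => eps eps0.
have [nu0|nu0] := leP (mu - eps) 0.
  apply: (@le_trans _ _ (0 + eps%:E)%E); first by rewrite add0e lee_fin; lra.
  by rewrite leeD2r //; apply: ereal_sup_ubound; left.
rewrite -[mu](subrK eps) EFinD leeD2r //; apply: ereal_sup_ubound; right.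
exists (mu - eps) => //; split => // /finite_height_bounded[T TP].
pose D := 12 * (n ^ 2)%:R * C `^ (mu - eps).
have [K1 K1P] : exists K : nat, D <= (2 ^+ K) `^ eps.
  have [K KP] : exists K : nat, D `^ eps^-1 <= 2 ^+ K.
    exists (Num.truncn (D `^ eps^-1)).+1; apply: le_trans (ltW (truncnS_gt _)) _.
    by rewrite -natrX ler_nat; apply: ltnW; apply: ltn_expl.
  exists K; have D0 : 0 <= D by rewrite !mulr_ge0 ?powR_ge0.
  have -> : D = (D `^ eps^-1) `^ eps by rewrite -powRrM mulVf ?lt0r_neq0 // powRr1.
  by apply: ge0_ler_powR; [exact: ltW|rewrite nnegrE powR_ge0|rewrite nnegrE exprn_ge0|].
have [K2 K2P] : exists K : nat, T < 2 ^+ K.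
  exists (Num.truncn T).+1; apply: lt_le_trans (truncnS_gt _) _.
  by rewrite -natrX ler_nat; apply: ltnW; apply: ltn_expl.
have [k kK kmu] := often (maxn K1 K2).
have big K : (K <= k)%N -> 2 ^+ K <= q k.
  by move=> Kk; rewrite ler_eXn2l ?ltr1n //; apply: leq_trans Kk (expo_ge_id g_ge2 k).
have q0 := q_gt0 g k; have q1 := q_ge1 g k.
have kK1 : (K1 <= k)%N by rewrite (leq_trans _ kK) ?leq_maxl.
have kK2 : (K2 <= k)%N by rewrite (leq_trans _ kK) ?leq_maxr.
have hq := frame_space_height_ge k; have qh := CP k.
suff : height (frame_space k) <= T.
  by have := big _ kK2; lra.
apply: TP; split; first exact: rational_frame_space.
apply: le_trans (frame_space_psi k) _.
have h0 : 0 < height (frame_space k) by lra.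
rewrite powRN -[leRHS]div1r ler_pdivlMr ?powR_gt0 // mulrAC ler_pdivrMr ?q_gt0 // mul1r.
apply: (@le_trans _ _ (D * q k `^ (mu - eps))).
  rewrite /D -mulrA -powRM ?ler_wpM2l ?mulr_ge0 //; [|exact: ltW..].
  by apply: ge0_ler_powR; rewrite ?nnegrE ?mulr_ge0 //; exact: ltW.
apply: (@le_trans _ _ (q k `^ eps * q k `^ (mu - eps))).
  rewrite ler_wpM2r ?powR_ge0 //; apply: le_trans K1P _.
  by apply: ge0_ler_powR; rewrite ?nnegrE ?exprn_ge0 ?(ltW eps0) ?(ltW q0) ?big.
rewrite -powRD; last by apply/implyP => _; rewrite gt_eqF.
rewrite addrC subrK; apply: (@le_trans _ _ (q k `^ window g k e.+1)).
  by rewrite ler_powR.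
by have := expo_window_powR_ge g_ge2 k e.+1; rewrite addnS.
Qed.

Context (mu c : R).
Hypothesis (c_gt0 : 0 < c).
Hypothesis cP : forall B, rational_subspaces e.+1 B ->
  forall x z, x \in A -> x != 0 -> z \in B -> z != 0 ->
    c * height B `^ (- mu) <= omega x z.

Lemma psi_ge (B : {vspace 'rV[R]_n}) : rational_subspaces e.+1 B -> c * height B `^ (- mu) <= psi 1 A B.
Proof.
move=> rB; have [[x [z [xA x0 zB z0 ->]]] _] := psi1P A_neq0 (rational_neq0 rB) (dims_le rB).
exact: cP.
Qed.

Lemma trivial_intersection (B : {vspace 'rV[R]_n}) : rational_subspaces e.+1 B -> (A :&: B)%VS = 0%VS.
Proof.
move=> rB; apply/eqP; rewrite -subv0; apply/subvP => x.
rewrite memv_cap memv0 => /andP[xA xB]; apply: contraT => x0.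
have := cP rB xA x0 xB x0; rewrite omega_self leNgt mulr_gt0 // powR_gt0 //.
by have := height_ge1 rB; lra.
Qed.

(** An approximation with exponent [nu > mu] forces [h ^ (nu - mu) <= c^-1]. *)
Lemma exponent_le : 0 <= mu -> (exponent A e.+1 1 <= mu%:E)%E.
Proof.
move=> mu0; apply: ge_ereal_sup => _ [->|[nu [nu0 nuinf] <-]]; first by rewrite lee_fin.
rewrite lee_fin leNgt; apply/negP => munu; apply: nuinf.
have t0 : 0 < nu - mu by lra.
apply: sub_finite_set (finite_bounded_height n e.+1 (c^-1 `^ (nu - mu)^-1)).
move=> B [rB psiB]; split => //.
have h1 := height_ge1 rB; set h := height B in psiB h1 *.
have h0 : 0 < h by lra.
have := le_trans (psi_ge rB) psiB; rewrite -/h => ch.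
have hn : 0 < h `^ nu by rewrite powR_gt0.
have ct : h `^ (nu - mu) <= c^-1.
  rewrite -(ler_pM2l c_gt0) mulfV ?gt_eqF //.
  have hD s t : h `^ s * h `^ t = h `^ (s + t).
    by rewrite powRD //; apply/implyP => _; rewrite gt_eqF.
  have := ler_wpM2r (ltW hn) ch; rewrite -mulrA !hD addNr powRr0.
  by rewrite [- mu + nu]addrC.
rewrite -[leLHS](powRr1 (ltW h0)) -(mulfV (lt0r_neq0 t0)) powRrM.
by apply: ge0_ler_powR; rewrite ?nnegrE ?powR_ge0 ?invr_ge0 // ltW.
Qed.

End Exponents.

(** * The constants and the sequence of ratios *)

Section Constants.
Context {R : realType}.

Lemma sqrt5_ge2 : 2 <= Num.sqrt (5 : R).
Proof.
have -> : 2 = Num.sqrt (2 ^+ 2 : R) by rewrite sqrtr_sqr ger0_norm.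
by apply: ler_wsqrtr; rewrite expr2; lra.
Qed.

(** The first constant is the larger root [(3 + sqrt 5) / 2]. *)
Lemma golden_ge (x : R) : Cst R 0 1 <= x -> 0 <= x ^+ 2 - 3 * x + 1.
Proof.
rewrite /Cst /= => xC; have s2 := sqrt5_ge2.
have s5 : Num.sqrt (5 : R) * Num.sqrt 5 = 5 by rewrite -expr2 sqr_sqrtr.
set s := Num.sqrt 5 in xC s2 s5.
have : (s / 2) * (s / 2) <= (x - 3 / 2) * (x - 3 / 2) by apply: ler_pM; lra.
rewrite expr2; lra.
Qed.

Lemma CstS n d : Cst R n d.+2 = 5 * n%:R ^+ 2 * Cst R n d.+1 ^+ (2 * n).
Proof. by []. Qed.

Lemma Cst1 n : Cst R n 1 = Cst R 0 1. Proof. by []. Qed.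

Lemma Cst1_ge : 5 / 2 <= Cst R 0 1.
Proof. by rewrite /Cst /=; have := sqrt5_ge2; lra. Qed.

Lemma CstS_ge n (c : R) : (0 < n)%N -> 1 <= c -> c <= 5 * n%:R ^+ 2 * c ^+ (2 * n).
Proof.
move=> n0 c1; have nn : 1 <= n%:R ^+ 2 :> R by rewrite exprn_ege1 // ler1n.
have c2 : c <= c ^+ (2 * n).
  by rewrite -[leLHS]expr1 ler_weXn2l // muln_gt0.
have : 1 * c ^+ (2 * n) <= 5 * n%:R ^+ 2 * c ^+ (2 * n).
  by rewrite ler_wpM2r ?exprn_ge0 //; lra.
lra.
Qed.

Lemma Cst_ge1 n d : (0 < n)%N -> Cst R 0 1 <= Cst R n d.+1.
Proof.
move=> n0; elim: d => [|d IH]; first by rewrite Cst1.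
rewrite CstS; apply: (le_trans IH); apply: CstS_ge => //.
by have := Cst1_ge; move: IH; lra.
Qed.

(** From the second constant on, there is room for all the polynomial losses. *)
Lemma Cst_ge_pow4 n d : (0 < n)%N -> 4 * n%:R ^+ 4 <= Cst R n d.+2.
Proof.
move=> n0; rewrite CstS.
have c2 : 2 <= Cst R n d.+1 by have := Cst_ge1 d n0; have := Cst1_ge; lra.
have n2 : n%:R ^+ 2 <= Cst R n d.+1 ^+ (2 * n).
  apply: (@le_trans _ _ (2 ^+ (2 * n))).
    rewrite mulnC exprM ler_pXn2r ?nnegrE ?exprn_ge0 // -natrX ler_nat.
    by apply: ltnW; apply: ltn_expl.
  by rewrite ler_pXn2r ?nnegrE ?muln_gt0 //; lra.
have : 5 * n%:R ^+ 2 * n%:R ^+ 2 <= 5 * n%:R ^+ 2 * Cst R n d.+1 ^+ (2 * n).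
  by rewrite ler_wpM2l // mulr_ge0 // exprn_ge0.
have : 0 <= n%:R ^+ 2 * n%:R ^+ 2 :> R by rewrite mulr_ge0 ?exprn_ge0.
have -> : n%:R ^+ 4 = n%:R ^+ 2 * n%:R ^+ 2 :> R by rewrite -exprD.
lra.
Qed.

End Constants.

Section PeriodicSequence.
Context {R : realType} (m : nat) (gamma : nat -> R) (C : R).
Hypothesis (m_gt0 : (0 < m)%N) (C_ge1 : 1 <= C).
Hypothesis gammaC : forall k, (1 <= k <= m)%N -> C <= gamma k.

(** The prescribed ratios followed by [m] copies of the smallest allowed one,
    so that no window of length at most [m] meets two blocks of ratios. *)
Definition ratios (k : nat) : R :=
  if (k %% (2 * m) < m)%N then gamma (k %% (2 * m)).+1 else C.

Let gam l := gamma l.+1.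

Lemma window_cat (g : nat -> R) k a b : window g k (a + b) = window g k a * window g (k + a) b.
Proof. by rewrite /window addnA (@big_cat_nat _ _ _ (k + a)) ?leq_addr. Qed.

Lemma windowE (g : nat -> R) k a : window g k a = \prod_(l < a) g (k + l)%N.
Proof.
rewrite /window -{1}[k]addn0 addnC (addnC k a) big_addn addnK big_mkord.
by apply: eq_bigr => l _; rewrite addnC.
Qed.

Lemma eq_window (g h : nat -> R) k l a :
  (forall i, (i < a)%N -> g (k + i)%N = h (l + i)%N) -> window g k a = window h l a.
Proof. by move=> gh; rewrite !windowE; apply: eq_bigr => i _; apply: gh. Qed.

Lemma window_const (g : nat -> R) k a :
  (forall i, (i < a)%N -> g (k + i)%N = C) -> window g k a = C ^+ a.
Proof.
move=> gC; rewrite windowE (eq_bigr (fun=> C)) => [|i _]; last exact: gC.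
by rewrite prodr_const card_ord.
Qed.

Lemma window_gam_ge k a : (k + a <= m)%N -> C ^+ a <= window gam k a.
Proof.
move=> kam; rewrite windowE -{1}[a]card_ord -prodr_const.
apply: ler_prod => i _; have := ltn_ord i => ia.
apply/andP; split; first by have := C_ge1; lra.
by apply: gammaC; lia.
Qed.

Lemma window_gam_ge0 k a : (k + a <= m)%N -> 0 <= window gam k a.
Proof. by move=> /window_gam_ge; apply: le_trans; rewrite exprn_ge0 //; have := C_ge1; lra. Qed.

Lemma ratios_ge k : C <= ratios k.
Proof. by rewrite /ratios; case: ifP => // km; apply: gammaC. Qed.

Lemma ratios_bounded : exists G, forall k, ratios k <= G.
Proof.
exists (C + \sum_(i < m.+1) `|gamma i|) => k; rewrite /ratios.
have S0 : 0 <= \sum_(i < m.+1) `|gamma i| by apply: sumr_ge0.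
case: ifP => [km|_]; last by rewrite lerDl.
have km' : ((k %% (2 * m)).+1 < m.+1)%N by rewrite ltnS.
rewrite -[leLHS]add0r; apply: lerD; first by have := C_ge1; lra.
apply: le_trans (ler_norm _) _.
by rewrite (bigD1 (Ordinal km')) //= lerDl sumr_ge0.
Qed.

Lemma ratios_gam t i : (i < m)%N -> ratios (2 * m * t + i) = gam i.
Proof.
move=> im; by rewrite /ratios mulnC modnMDl modn_small ?im // (leq_trans im) // leq_pmull.
Qed.

Lemma ratios_C t i : (m <= i < 2 * m)%N -> ratios (2 * m * t + i) = C.
Proof.
move=> im; rewrite /ratios mulnC modnMDl modn_small; last by lia.
by rewrite ltnNge; case/andP: im => ->.
Qed.

(** A window meeting a block of ratios at one end only is compared to the window
    pushed entirely into this block: the terms [C] that leave are replaced by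
    larger ones. *)
Lemma window_ratios_le e k : (e <= m)%N ->
  exists2 i, (i <= m - e)%N & window ratios k e <= window gam i e.
Proof.
move=> em; pose t := (k %/ (2 * m))%N; pose p := (k %% (2 * m))%N.
have kE : k = (2 * m * t + p)%N by rewrite [LHS](divn_eq k (2 * m)) mulnC.
have p2 : (p < 2 * m)%N by rewrite ltn_mod muln_gt0.
have [pm|mp] := ltnP p m.
  have [pem|mpe] := leqP (p + e) m.
    exists p; first by lia.
    rewrite (@eq_window _ gam k p e) // => i ie.
    by rewrite kE -addnA ratios_gam //; lia.
  exists (m - e)%N => //.
  have -> : window ratios k e =
      window ratios k (m - p) * window ratios (k + (m - p)) (e - (m - p)).
    by rewrite -window_cat; congr (window _ _ _); lia.
  have -> : window gam (m - e) e =
      window gam (m - e) (e - (m - p)) * window gam p (m - p).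
    have {2}-> : p = (m - e + (e - (m - p)))%N by lia.
    by rewrite -window_cat; congr (window _ _ _); lia.
  rewrite (@eq_window ratios gam k p) => [|i ie]; last first.
    by rewrite kE -addnA ratios_gam //; lia.
  rewrite (@window_const _ (k + (m - p))) => [|i ie]; last first.
    by rewrite kE -!addnA ratios_C //; lia.
  rewrite mulrC ler_wpM2r ?window_gam_ge0 ?window_gam_ge //; lia.
exists 0%N => //.
have [pe|pe] := leqP (p + e) (2 * m).
  rewrite (@window_const ratios k) => [|i ie]; last first.
    by rewrite kE -!addnA ratios_C //; lia.
  by apply: window_gam_ge.
have -> : window ratios k e =
    window ratios k (2 * m - p) * window ratios (k + (2 * m - p)) (e - (2 * m - p)).
  by rewrite -window_cat; congr (window _ _ _); lia.
have -> : window gam 0 e =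
    window gam 0 (e - (2 * m - p)) * window gam (e - (2 * m - p)) (2 * m - p).
  by rewrite -{2}[(e - (2 * m - p))%N]add0n -window_cat; congr (window _ _ _); lia.
rewrite (@window_const ratios k) => [|i ie]; last first.
  by rewrite kE -!addnA ratios_C //; lia.
rewrite (@eq_window ratios gam (k + (2 * m - p)) 0) => [|i ie]; last first.
  rewrite add0n -(@ratios_gam t.+1) //; last by lia.
  by congr ratios; rewrite kE mulnS; lia.
rewrite mulrC ler_wpM2l ?window_gam_ge0 ?window_gam_ge //; lia.
Qed.

Lemma window_ratios_often e i N : (i + e <= m)%N ->
  exists2 k, (N <= k)%N & window ratios k e = window gam i e.
Proof.
move=> iem; exists (2 * m * N + i)%N.
  by apply: leq_trans (leq_addr _ _); rewrite leq_pmull // muln_gt0.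
apply: eq_window => j je.
by rewrite -addnA ratios_gam // (leq_trans _ iem) // ltn_add2l.
Qed.

End PeriodicSequence.

Lemma exists_argmax (R : realType) (f : nat -> R) N :
  exists2 i, (i <= N)%N & forall j, (j <= N)%N -> f j <= f i.
Proof.
elim: N => [|N [i iN fi]]; first by exists 0%N => // j; rewrite leqn0 => /eqP ->.
have [le|lt] := leP (f N.+1) (f i).
  exists i => [|j]; first exact: leqW.
  by rewrite leq_eqVlt => /orP[/eqP -> //|]; apply: fi.
exists N.+1 => // j; rewrite leq_eqVlt => /orP[/eqP -> //|jN].
by apply: le_trans (ltW lt); apply: fi.
Qed.

Lemma bigmaxe_argmax (R : realType) (f : nat -> R) N i : (i <= N)%N ->
  (forall j, (j <= N)%N -> f j <= f i) ->
  \big[maxe/-oo%E]_(0 <= j < N.+1) (f j)%:E = (f i)%:E.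
Proof.
move=> iN fi; rewrite big_mkord; apply/eqP; rewrite eq_le; apply/andP; split.
  apply: bigmax_le => [|j _]; first exact: leNye.
  by rewrite lee_fin; apply: fi; rewrite -ltnS.
have iN' : (i < N.+1)%N by rewrite ltnS.
exact: (Order.TotalTheory.bigmax_sup (Ordinal iN')).
Qed.

Lemma prescribed_exponents (R : realType) (m r : nat) (gamma : nat -> R) (C : R) :
  (0 < m)%N -> Cst R 0 1 <= C ->
  r = 0%N \/ 4 * (m.+1 + r)%:R ^+ 4 <= C ->
  (forall k, (1 <= k <= m)%N -> C <= gamma k) ->
  exists2 A : {vspace 'rV[R]_(m.+1 + r)},
    irrational_subspaces r.+1 m 1 A &
    forall e : nat, (1 <= e <= m)%N ->
      exponent A e 1 =
      \big[maxe/-oo%E]_(0 <= i < (m - e).+1) (\prod_(i.+1 <= k < (i + e).+1) gamma k)%:E.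
Proof.
move=> m0 C1 Cr gammaC; set n := (m.+1 + r)%N in Cr *.
have C2 : 2 <= C by have := @Cst1_ge R; lra.
have C10 : 1 <= C by lra.
pose g := ratios m gamma C; pose gam l := gamma l.+1.
have gC k : C <= g k by apply: ratios_ge.
have g2 k : 2 <= g k by apply: le_trans C2 (gC k).
have [G gG] := ratios_bounded m gamma C10.
have gold k : 0 <= g k ^+ 2 - 3 * g k + 1 by apply: golden_ge; apply: le_trans C1 (gC k).
have /choice[i0 i0P] : forall e, exists i, (i <= m - e.+1)%N /\
    forall j, (j <= m - e.+1)%N -> window gam j e.+1 <= window gam i e.+1.
  by move=> e; have [i iN fi] := exists_argmax (fun j => window gam j e.+1) (m - e.+1); exists i.
pose mu e := window gam (i0 e) e.+1.
have gmu e k : (e < m)%N -> window g k e.+1 <= mu e.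
  move=> em; have [i iN] := window_ratios_le m0 C10 gammaC k em.
  by move=> /le_trans; apply; apply: (i0P e).2.
have often e : (e < m)%N -> forall N, exists2 k, (N <= k)%N & mu e <= window g k e.+1.
  move=> em N; have [|k Nk kE] := @window_ratios_often R m gamma C m0 e.+1 (i0 e) N.
    by have [] := i0P e; lia.
  by exists k => //; rewrite /g kE.
have muC e : (e < m)%N -> C <= mu e.
  move=> em; apply: le_trans (gmu e 0%N em); rewrite windowSl.
  apply: le_trans (gC 0%N) _; rewrite ler_peMr //; first by have := g2 0%N; lra.
  by apply: window_ge1 => l; have := g2 l; lra.
have skew : r = 0%N \/ (exists gmin, [/\ 2 <= gmin, forall k, gmin <= g k & forall e, (e < m)%N ->
    (generic_loss m r)%:R + e.+2%:R + e.+1%:R * (mu e / (gmin - 1)) <= mu e]).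
  case: Cr => [->|Cn]; [by left|right]; exists C; split => // e em.
  have muCe := muC e em.
  have n1 : (1 <= n)%N by [].
  have loss : (generic_loss m r + e.+2 <= 2 * n ^ 4)%N.
    have : (generic_loss m r <= n ^ 2 * n ^ 2)%N.
      by apply: leq_mul; rewrite expnS expn1 /n; nia.
    have n4 : (n <= n ^ 4)%N by rewrite -{1}[n]expn1 leq_pexp2l.
    have en : (e.+2 <= n)%N by rewrite /n; lia.
    rewrite -expnD; lia.
  have lossR : (generic_loss m r)%:R + e.+2%:R <= mu e / 2.
    move: loss; rewrite -(ler_nat R) natrD natrM natrX => loss.
    lra.
  have small : e.+1%:R * (mu e / (C - 1)) <= mu e / 2.
    rewrite mulrCA ler_wpM2l //; first by lra.
    rewrite ler_pdivrMr; last by lra.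
    have : (2 * e.+1 + 1 <= 4 * n ^ 4)%N.
      have n4 : (n <= n ^ 4)%N by rewrite -{1}[n]expn1 leq_pexp2l.
      have en : (e.+2 <= n)%N by rewrite /n; lia.
      lia.
    rewrite -(ler_nat R) natrD natrM (natrM _ 4) natrX => small.
    lra.
  lra.
have [eta core] := core_bound m0 g2 gG gold gmu skew.
have exps e : (e < m)%N -> exponent (graph_space (target m g) eta) e.+1 1 = (mu e)%:E.
  move=> em; have [c c0 cP] := core e em.
  apply/eqP; rewrite eq_le; apply/andP; split.
    have mu0 : 0 <= mu e by have := muC e em; lra.
    exact: (exponent_le m0 g2 em c0 cP mu0).
  by apply: exponent_ge => //; apply: often.
exists (graph_space (target m g) eta).
  split; first exact: dimA.
  move=> B rB; have rB' : rational_subspaces m.-1.+1 B by rewrite prednK.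
  have [|c c0 cP] := core m.-1; first by lia.
  by rewrite (trivial_intersection c0 cP rB') dimv0.
move=> [//|e] /andP[_ em]; rewrite exps //.
have [iN imax] := i0P e.
have WE i : \prod_(i.+1 <= k < (i + e.+1).+1) gamma k = window gam i e.+1.
  by rewrite /window big_add1.
under eq_bigr => i _ do rewrite WE.
by rewrite (bigmaxe_argmax iN imax).
Qed.


Theorem theorem1p7 (R : realType) (n d : nat) (hn : (2 <= n)%N)
    (hd : (1 <= d <= n - 1)%N) :
  0 < Cst R n d /\
  forall gamma : nat -> R,
    (forall k, (1 <= k <= n - d)%N -> Cst R n d <= gamma k) ->
    exists2 A : {vspace 'rV[R]_n},
      irrational_subspaces d (n - d) 1 A &
      forall e : nat, (1 <= e <= n - d)%N ->
        exponent A e 1 =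
        \big[maxe/-oo%E]_(0 <= i < (n - d - e).+1)
          (\prod_(i.+1 <= k < (i + e).+1) gamma k)%:E.
Proof.
have n0 : (0 < n)%N by lia.
case: d hd => // r hd.
have C1 : Cst R 0 1 <= Cst R n r.+1 := Cst_ge1 r n0.
split; first by have := @Cst1_ge R; lra.
move=> gamma gammaC; pose m := (n - r.+1)%N.
have m0 : (0 < m)%N by rewrite /m; lia.
have nE : n = (m.+1 + r)%N by rewrite /m; lia.
rewrite -/m in gammaC *; move: (m) m0 nE gammaC => {}m m0 nE gammaC; subst n.
apply: (prescribed_exponents m0 C1 _ gammaC).
by case: (r) => [|s]; [left|right; apply: Cst_ge_pow4].
Qed.
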